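(* Let $D$ be a positive integer. Let $(Z,S)$ be an aperiodic zero-dimensional topological dynamical system, and let $\pi:(X,T)\to(Z,S)$ be a factor map (so $(X,T)$ is an extension of $(Z,S)$). If $\mathrm{mdim}(X,T)<D/2$, then there exists a continuous map $f:X\to[0,1]^{D}$ such that \[ (I_{f},\pi):X\to\left([0,1]^{D}\right)^{\mathbb{Z}}\times Z,\quad x\mapsto(I_{f}(x),\pi(x)), \] is a topological embedding. Moreover, the set of continuous maps $f:X\to[0,1]^{D}$ with this property is comeagre in $C(X,[0,1]^{D})$ (the space of continuous maps $X\to[0,1]^D$ with the uniform topology).
   Context: A topological dynamical system (t.d.s.) $(X,T)$ consists of a compact metric space $X$ and a homeomorphism $T:X\to X$. It is aperiodic if it has no periodic points, and zero-dimensional if $X$ is zero-dimensional (clopen sets form a basis). A factor map $\pi:(X,T)\to(Z,S)$ is a continuous surjection with $\pi T=S\pi$. For a continuous $f:X\to[0,1]^D$, $I_f:X\to([0,1]^D)^{\mathbb{Z}}$ is $I_f(x)=(f(T^nx))_{n\in\mathbb{Z}}$. Mean dimension: for a compact metric space $(X,d)$ and $\varepsilon>0$, a continuous map $F:X\to Y$ is an $\varepsilon$-embedding if $\mathrm{diam}(F^{-1}(y))<\varepsilon$ for all $y\in Y$; $\mathrm{widim}_\varepsilon(X,d)$ is the minimal $n\ge 0$ such that there is an $\varepsilon$-embedding of $X$ into an $n$-dimensional polytope (equivalently, an open cover of $X$ by sets of diameter $<\varepsilon$ of order at most $n$, i.e. any $n+2$ distinct members have empty intersection). For integers $a<b$,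 $d_a^b(x,y)=\max_{a\le i\le b}d(T^ix,T^iy)$. Then $\mathrm{mdim}(X,T)=\sup_{\varepsilon>0}\lim_{n\to\infty}\frac{\mathrm{widim}_\varepsilon(X,d_0^{n-1})}{n}$ (the limit exists; value may be $\infty$). *)

(* Defs.v *)
From Stdlib Require Import Reals Lra List ZArith.
Open Scope R_scope.

Definition d_open {P : Type} (d : P -> P -> R) (U : P -> Prop) : Prop :=
  forall x, U x -> exists r, 0 < r /\ forall y, d x y < r -> U y.

Record CompactMetricSpace := {
  cms_pt :> Type;
  cms_d : cms_pt -> cms_pt -> R;
  cms_d_nonneg : forall x y, 0 <= cms_d x y;
  cms_d_eq0 : forall x y, cms_d x y = 0 <-> x = y;
  cms_d_sym : forall x y, cms_d x y = cms_d y x;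
  cms_d_tri : forall x y z, cms_d x z <= cms_d x y + cms_d y z;
  cms_compact : forall (I : Type) (U : I -> cms_pt -> Prop),
     (forall i, d_open cms_d (U i)) -> (forall x, exists i, U i x) ->
     exists l : list I, forall x, exists i, In i l /\ U i x
}.

Definition continuous (X Y : CompactMetricSpace) (f : X -> Y) : Prop :=
  forall x eps, 0 < eps -> exists del, 0 < del /\
    forall x', cms_d X x x' < del -> cms_d Y (f x) (f x') < eps.

Definition is_homeo (X : CompactMetricSpace) (T Tinv : X -> X) : Prop :=
  continuous X X T /\ continuous X X Tinv /\
  (forall x, T (Tinv x) = x) /\ (forall x, Tinv (T x) = x).

Definition iterZ {P : Type} (T Tinv : P -> P) (n : Z) (x : P) : P :=
  match n with
  | Z0 => x
  | Zpos p => Nat.iter (Pos.to_nat p) T x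
  | Zneg p => Nat.iter (Pos.to_nat p) Tinv x
  end.

Definition aperiodic (Z : CompactMetricSpace) (S : Z -> Z) : Prop :=
  forall z (n : nat), (1 <= n)%nat -> Nat.iter n S z <> z.

Definition clopen (Z : CompactMetricSpace) (V : Z -> Prop) : Prop :=
  d_open (cms_d Z) V /\ d_open (cms_d Z) (fun z => ~ V z).

Definition zero_dim (Z : CompactMetricSpace) : Prop :=
  forall (U : Z -> Prop) z, d_open (cms_d Z) U -> U z ->
    exists V, clopen Z V /\ V z /\ forall w, V w -> U w.

Definition factor_map (X Z : CompactMetricSpace) (T : X -> X) (S : Z -> Z)
  (pi : X -> Z) : Prop :=
  continuous X Z pi /\ (forall z, exists x, pi x = z) /\
  (forall x, pi (T x) = S (pi x)).

Definition dmax (X : CompactMetricSpace) (T : X -> X) (n : nat) (x y : X) : R :=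
  fold_right Rmax 0
    (map (fun i => cms_d X (Nat.iter i T x) (Nat.iter i T y)) (seq 0 n)).

Definition widim_le (X : CompactMetricSpace) (T : X -> X) (eps : R) (n k : nat)
  : Prop :=
  exists (I : Type) (U : I -> X -> Prop),
    (forall i, d_open (dmax X T n) (U i)) /\
    (forall x, exists i, U i x) /\
    (forall i, exists r, r < eps /\
        forall x y, U i x -> U i y -> dmax X T n x y <= r) /\
    (forall l : list I, NoDup l -> length l = (k + 2)%nat ->
        ~ exists x, forall i, In i l -> U i x).

(* mdim(X,T) < a :  sup_eps lim_n widim_eps(X,d_0^{n-1})/n < a,
   i.e. some c < a bounds every lim_n widim_eps/n. *)
Definition mdim_lt (X : CompactMetricSpace) (T : X -> X) (a : R) : Prop :=
  exists c, c < a /\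
    forall eps eta, 0 < eps -> 0 < eta ->
      exists N : nat, forall n : nat, (N <= n)%nat -> (1 <= n)%nat ->
        exists k : nat, INR k <= (c + eta) * INR n /\ widim_le X T eps n k.

(* Elements of C(X,[0,1]^D): maps X -> nat -> R, coordinates i < D in [0,1],
   coordinates i >= D fixed to 0, continuous for the max metric on [0,1]^D. *)
Definition cube_map (X : CompactMetricSpace) (D : nat) (f : X -> nat -> R) : Prop :=
  (forall x i, (i < D)%nat -> 0 <= f x i <= 1) /\
  (forall x i, (D <= i)%nat -> f x i = 0) /\
  (forall x eps, 0 < eps -> exists del, 0 < del /\
     forall x', cms_d X x x' < del ->
       forall i, (i < D)%nat -> Rabs (f x i - f x' i) < eps).

Definition I_f (X : CompactMetricSpace) (T Tinv : X -> X) (f : X -> nat -> R)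
  (x : X) : Z -> nat -> R :=
  fun n => f (iterZ T Tinv n x).

Definition prod_nbhd (Zs : CompactMetricSpace) (D : nat) (N : nat) (e : R)
  (u : Z -> nat -> R) (z : Zs) (v : Z -> nat -> R) (z' : Zs) : Prop :=
  (forall n : Z, (Z.abs n <= Z.of_nat N)%Z -> forall i, (i < D)%nat ->
      Rabs (u n i - v n i) < e) /\ cms_d Zs z z' < e.

Definition embedding_pair (X Zs : CompactMetricSpace) (T Tinv : X -> X) (D : nat)
  (f : X -> nat -> R) (pi : X -> Zs) : Prop :=
  let F := I_f X T Tinv f in
  (forall x (N : nat) e, 0 < e -> exists del, 0 < del /\
     forall x', cms_d X x x' < del -> prod_nbhd Zs D N e (F x) (pi x) (F x') (pi x'))
  /\ (forall x x', (forall n i, (i < D)%nat -> F x n i = F x' n i) -> pi x = pi x' -> x = x')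
  /\ (forall x eps, 0 < eps -> exists (N : nat) e, 0 < e /\
     forall x', prod_nbhd Zs D N e (F x) (pi x) (F x') (pi x') -> cms_d X x x' < eps).

Definition uball (X : CompactMetricSpace) (D : nat) (f g : X -> nat -> R) (e : R) : Prop :=
  exists r, r < e /\ forall x i, (i < D)%nat -> Rabs (f x i - g x i) <= r.

Definition C_open (X : CompactMetricSpace) (D : nat) (U : (X -> nat -> R) -> Prop) : Prop :=
  forall f, cube_map X D f -> U f -> exists e, 0 < e /\
    forall g, cube_map X D g -> uball X D f g e -> U g.

Definition C_dense (X : CompactMetricSpace) (D : nat) (U : (X -> nat -> R) -> Prop) : Prop :=
  forall f, cube_map X D f -> forall e, 0 < e ->
    exists g, cube_map X D g /\ U g /\ uball X D f g e.

Definition comeagre_C (X : CompactMetricSpace) (D : nat) (P : (X -> nat -> R) -> Prop) : Prop :=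
  exists U : nat -> (X -> nat -> R) -> Prop,
    (forall k, C_open X D (U k)) /\ (forall k, C_dense X D (U k)) /\
    (forall f, cube_map X D f -> (forall k, U k f) -> P f).

(* Main.v *)
(** By Baire it suffices that, for each [eps], the maps [f] for which [(I_f, pi)] is a uniform
[eps]-embedding are dense. Aperiodicity and zero-dimensionality give a clopen marker set [W] in
[Zs] whose return times are bounded and larger than any prescribed [N]. Since the mean dimension
is below [D/2], a general position argument perturbs, for every [n > N], the block
[(f x, ..., f (T^(n-1) x))] to an [eps]-embedding into [[0,1]^(n*D)] for the metric [dmax X T n].
Between two consecutive visits of [pi x] to [W], [n] steps apart, the new map reads off the
corresponding letter of the perturbed [n]-block; it is continuous because [W] is clopen, and
[(I_g x, pi x)] determines the visits and hence the blocks. *)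
Require Import Defs.
From mathcomp Require all_boot all_order all_algebra Rstruct.
From Stdlib Require Import Reals Lra Lia List Classical ClassicalEpsilon ZArith.
Open Scope R_scope.

(** The bound [D/2] is a count of vertices. In a cover of order [k] a point lies in at most [k + 1]
    members, so comparing two points involves at most [2k + 2] vertices of the nerve, and to place
    these affinely independently takes dimension [2k + 1]. A strict inequality [c < D/2] leaves
    [2k + 1 <= n * D] for all large [n]. Block lengths vary along and between orbits, so block maps
    for all [n > N] are prepared at once, without any relation between them. None is required: two
    points in the same fibre of [pi] have the same visits, hence are compared through the same block
    map, and points in different fibres are told apart by [pi] itself. Since the block structure is
    locally constant, the new map may switch between unrelated block maps without interpolation, and
    every letter of a block stays available for coding. *)

Fixpoint rsum (n : nat) (g : nat -> R) : R :=
  match n with O => 0 | S k => rsum k g + g k end.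

(** * General position in the cube *)

Module GeneralPosition.
Import all_boot all_order all_algebra.
Import Order.TTheory GRing.Theory Num.Theory.
Set Implicit Arguments. Unset Strict Implicit. Unset Printing Implicit Defensive.
Local Open Scope nat_scope.
Local Open Scope ring_scope.

(** The [size Q] distinct points [e / (i+1)] outnumber the roots of [Q], of which there are fewer
    than [size Q]. *)
Lemma exists_small_nonroot (R : realFieldType) (Q : {poly R}) (e : R) :
  Q != 0 -> 0 < e -> exists2 t, 0 < t <= e & ~~ root Q t.
Proof.
move=> Q0 e0; pose s := [seq e / (i.+1)%:R | i <- iota 0 (size Q)].
have us : uniq s.
  rewrite map_inj_in_uniq ?iota_uniq // => i j _ _ /(mulfI (lt0r_neq0 e0)).
  by move/invr_inj/eqP; rewrite eqr_nat eqSS => /eqP.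
have := max_poly_roots Q0; move=> /(_ s); rewrite us size_map size_iota ltnn.
case: (altP allP) => [_ /(_ isT isT)//|/allPn[_ /mapP[i _ ->] nr] _].
exists (e / (i.+1)%:R) => //.
by rewrite divr_gt0 ?ltr0n //= ler_pdivrMr ?ltr0n // ler_peMr ?(ltW e0) // ler1n.
Qed.

(* Move each [p a] a little towards the point of the moment curve with parameter [1/(a+1)]:
   the minors are polynomials in the step [t], nonzero at [t = 1] by Vandermonde. *)
Lemma general_position (R : realFieldType) (m L : nat) (p : nat -> nat -> R) (e : R) :
  0 < e -> (forall a j, 0 <= p a j <= 1) ->
  exists q : nat -> nat -> R,
    [/\ forall a j, 0 <= q a j <= 1,
        forall a j, `|q a j - p a j| <= e &
        forall (c : nat -> R) (l : seq nat), (size l <= m.+1)%N ->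
          (forall a, (a < L)%N -> c a != 0 -> a \in l) ->
          \sum_(a < L) c a = 0 ->
          (forall j, (j < m)%N -> \sum_(a < L) c a * q a j = 0) ->
          forall a, (a < L)%N -> c a = 0].
Proof.
move=> e0 p01.
(* The [m.+1] dummy indices allow every list of at most [m.+1] indices below [L] to be completed to
   exactly [m.+1] distinct ones, even when [L] is small. *)
pose K := (L + m.+1)%N.
pose u (a : nat) : R := (a.+1)%:R^-1.
have u01 a n : 0 <= u a ^+ n <= 1.
  rewrite exprn_ge0 ?invr_ge0 ?ler0n //= exprn_ile1 ?invr_ge0 ?ler0n //.
  by rewrite invf_le1 ?ler1n ?ltr0n.
(* The column of ones turns affine independence into linear independence; it stays constant under
   the deformation because [u a ^+ 0 = 1]. *)
pose A (a j : nat) : R := if j is j'.+1 then p a j' else 1.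
pose M (s : m.+1.-tuple 'I_K) : 'M[{poly R}]_m.+1 :=
  \matrix_(i, j) ((A (tnth s i) j)%:P * (1 - 'X) + (u (tnth s i) ^+ j)%:P * 'X).
(* The product over all choices of [m.+1] distinct indices lets a single [t] keep all minors
   nonzero. *)
pose Q := \prod_(s : m.+1.-tuple 'I_K | uniq s) \det (M s).
have Q0 : Q != 0.
  apply/prodf_neq0 => s us; apply: contraTneq isT => M0.
  have := congr1 (fun P => P.[1]) M0; rewrite horner0.
  rewrite -[LHS]/(horner_eval 1 _) -det_map_mx.
  have -> : map_mx (horner_eval 1) (M s) =
      (Vandermonde m.+1 (\row_i u (tnth s i)))^T.
    by apply/matrixP => i j; rewrite !mxE /= /horner_eval !hornerE subrr mulr0 add0r ?mulr1 ?addr0 .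
  rewrite det_tr det_Vandermonde => /eqP; rewrite -[_ == 0]negbK; case/negP.
  apply/prodf_neq0 => i _; apply/prodf_neq0 => j ij; rewrite !mxE subr_eq0.
  apply/eqP => /invr_inj/eqP; rewrite eqr_nat eqSS => /eqP/val_inj/(tuple_uniqP _ us) E.
  by rewrite E ltnn in ij.
(* The bound [t <= e] controls the displacement, and [t <= 1] makes [q a] a convex combination of
   two points of the cube. *)
have m0 : 0 < Num.min e 1 by rewrite lt_min e0 ltr01.
have [t /andP[t0]] := exists_small_nonroot Q0 m0.
rewrite le_min => /andP[te t1] nQ.
exists (fun a j => p a j * (1 - t) + u a ^+ j.+1 * t); split.
- move=> a j; have /andP[pa pb] := p01 a j; have /andP[ua ub] := u01 a j.+1.
  have t1' : 0 <= 1 - t by rewrite subr_ge0.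
  rewrite addr_ge0 ?mulr_ge0 ?(ltW t0) //=.
  rewrite -[leRHS](subrK t) lerD // ler_piMl // ltW //.
- move=> a j; have /andP[pa pb] := p01 a j; have /andP[ua ub] := u01 a j.+1.
  have -> : p a j * (1 - t) + u a ^+ j.+1 * t - p a j = (u a ^+ j.+1 - p a j) * t.
    by rewrite mulrBr mulr1 mulrBl addrAC [_ - _ - p a j]addrAC subrr add0r addrC.
  rewrite normrM (gtr0_norm t0) (le_trans _ te) // ler_piMl ?(ltW t0) //.
  rewrite ler_norml lerBrDr lerBlDr; apply/andP; split.
    by rewrite (le_trans _ ua) // addrC subr_le0.
  by rewrite (le_trans ub) // lerDl.

move=> c l sl supp s0 sj a aL; apply: contraTeq isT => ca0.
pose c' (b : nat) := if (b < L)%N then c b else 0.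
(* With the indices of [l] listed first, cutting at length [m.+1] keeps all of them, so the tuple
   [s] contains the support of [c']. *)
pose in_l := [seq x : 'I_K <- enum 'I_K | val x \in l].
pose out_l := [seq x : 'I_K <- enum 'I_K | val x \notin l].
have uin : uniq in_l by rewrite filter_uniq ?enum_uniq.
have szin : (size in_l <= m.+1)%N.
  apply: leq_trans sl; rewrite -(size_map val) uniq_leq_size //.
    by rewrite map_inj_uniq //; apply: val_inj.
  by move=> _ /mapP[x + ->]; rewrite mem_filter => /andP[].
have szs : size (take m.+1 (in_l ++ out_l)) == m.+1.
  rewrite size_takel // size_cat !size_filter count_predC -cardE card_ord.
  exact: leq_addl.
pose s : m.+1.-tuple 'I_K := Tuple szs.
have us : uniq s.
  rewrite take_uniq // cat_uniq uin filter_uniq ?enum_uniq // andbT.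
  by apply/hasPn => x; rewrite !mem_filter => /andP[xl _]; rewrite negb_and xl.
have sub x : c' (val x) != 0 -> x \in s.
  rewrite /c'; case: ifP => [xL cx|_ /eqP//].
  have xi : x \in in_l by rewrite mem_filter mem_enum supp.
  by rewrite /s memtE /= take_cat ltnNge szin /= mem_cat xi.
have sumE (v : nat -> R) : \sum_(i < m.+1) c' (tnth s i) * v (tnth s i) =
    \sum_(b < L) c b * v b.
  rewrite -(big_tuple _ _ s xpredT (fun x : 'I_K => c' x * v x)) big_uniq //=.
  rewrite [LHS]big_mkcond /=.
  rewrite (eq_bigr (fun x : 'I_K => c' x * v x)); last first.
    move=> x _; case: ifPn => // xs; case: (eqVneq (c' x) 0) => [->|/sub xin].
      by rewrite mul0r.
    by rewrite xin in xs.
  rewrite big_split_ord /= [X in _ + X]big1 ?addr0; last first.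
    by move=> i _; rewrite /c' /= ltnNge leq_addr /= mul0r.
  by apply: eq_bigr => i _; rewrite /c' /= ltn_ord.
pose N := map_mx (horner_eval t) (M s).
have Nu : N \in unitmx.
  rewrite unitmxE unitfE det_map_mx /= /horner_eval.
  apply: contraNneq nQ => Ms0; rewrite /root /Q horner_prod.
  by rewrite (bigD1 s) //= Ms0 mul0r.
pose w : 'rV[R]_m.+1 := \row_i c' (tnth s i).
have wN : w *m N = 0.
  apply/rowP => j; rewrite !mxE.
  pose v (b : nat) := A b j * (1 - t) + u b ^+ j * t.
  transitivity (\sum_(i < m.+1) c' (tnth s i) * v (tnth s i)).
    by apply: eq_bigr => i _; rewrite !mxE /= /horner_eval !hornerE.
  rewrite sumE {}/v; case: j => [[|j] /= jm]; last exact: sj.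
  by rewrite -[RHS]s0; apply: eq_bigr => i _; rewrite expr0 !mul1r subrK mulr1.
have w0 : w = 0 by rewrite -[w](mulmxK Nu) wN mul0mx.
have /tnthP[i ia] : lshift m.+1 (Ordinal aL) \in s by rewrite sub //= /c' aL.
have := congr1 (fun w : 'rV[R]_m.+1 => w 0 i) w0.
by rewrite !mxE -ia /c' /= aL => /eqP; rewrite (negPf ca0).
Qed.

Import Rstruct.

Lemma rsumE (n : nat) (g : nat -> R) : rsum n g = \sum_(i < n) g i.
Proof. by elim: n => [|n IH]; rewrite ?big_ord0 // big_ord_recr /= IH. Qed.

Lemma general_position_R (m L : nat) (p : nat -> nat -> R) (e : R) :
  Rlt (IZR Z0) e -> (forall a j, Rle (IZR Z0) (p a j) /\ Rle (p a j) (IZR (Zpos xH))) ->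
  exists q : nat -> nat -> R,
    (forall a j, Rle (IZR Z0) (q a j) /\ Rle (q a j) (IZR (Zpos xH))) /\
    (forall a j, Rle (Rabs (Rminus (q a j) (p a j))) e) /\
    (forall (c : nat -> R) (l : list nat), le (length l) (S m) ->
       (forall a, lt a L -> c a <> (IZR Z0) -> List.In a l) ->
       rsum L c = (IZR Z0) ->
       (forall j, lt j m -> rsum L (fun a => Rmult (c a) (q a j)) = (IZR Z0)) ->
       forall a, lt a L -> c a = (IZR Z0)).
Proof.
move=> /RltP e0 p01.
have p01' a j : 0 <= p a j <= 1.
  by have [/RleP pa /RleP pb] := p01 a j; rewrite pa.
have [q [q01 qp qi]] := general_position m L e0 p01'.
exists q; split; [|split].
- by move=> a j; have /andP[/RleP qa /RleP qb] := q01 a j.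
- by move=> a j; apply/RleP/qp.
move=> c l /ssrnat.leP sl supp s0 sj a /ssrnat.ltP aL; apply: (qi c l) => //.
- move=> b /ssrnat.ltP bL /eqP cb; have := supp b bL cb.
  by elim: (l) => //= x r IH [->|/IH]; rewrite in_cons ?eqxx // orbC => ->.
- by rewrite -rsumE.
- by move=> j /ssrnat.ltP jm; rewrite -(rsumE L (fun a => c a * q a j)) sj.
Qed.
End GeneralPosition.

(** * Compactness tools and integer iterates *)

Lemma functional_choice (A B : Type) (Rel : A -> B -> Prop) :
  (forall x, exists y, Rel x y) -> exists f, forall x, Rel x (f x).
Proof.
  intros H.
  exists (fun x => proj1_sig (constructive_indefinite_description _ (H x))).
  intros x. exact (proj2_sig (constructive_indefinite_description _ (H x))).
Qed.

Lemma cms_d_refl (X : CompactMetricSpace) (x : X) : cms_d X x x = 0.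
Proof. apply cms_d_eq0; reflexivity. Qed.

Lemma inv_INR_pos (n : nat) : 0 < / (INR n + 1).
Proof. apply Rinv_0_lt_compat. pose proof (pos_INR n); lra. Qed.

Lemma inv_INR_le (m n : nat) : (m <= n)%nat -> / (INR n + 1) <= / (INR m + 1).
Proof.
  intros H. apply le_INR in H. pose proof (pos_INR m).
  apply Rinv_le_contravar; lra.
Qed.

Lemma inv_INR_small (r : R) : 0 < r -> exists N : nat, / (INR N + 1) < r.
Proof.
  intros Hr. destruct (archimed_cor1 r Hr) as [N [HN HN0]].
  exists N. apply Rle_lt_trans with (2 := HN).
  apply Rinv_le_contravar; [apply lt_0_INR; lia | lra].
Qed.

Lemma open_ball (X : CompactMetricSpace) (x : X) (r : R) :
  d_open (cms_d X) (fun y => cms_d X x y < r).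
Proof.
  intros y Hy. exists (r - cms_d X x y). split; [lra|].
  intros z Hz. pose proof (cms_d_tri X x y z). lra.
Qed.

(** Balls on which one index works cover [X]; by monotonicity the largest index of a finite subcover
    works everywhere. With [/ (INR N + 1)] as a radius or tolerance, it also produces uniform
    positive reals. *)
Lemma compact_uniform (X : CompactMetricSpace) (P : nat -> X -> Prop) :
  (forall m n x, (m <= n)%nat -> P m x -> P n x) ->
  (forall x, exists r, 0 < r /\ exists N, forall y, cms_d X x y < r -> P N y) ->
  exists N, forall x, P N x.
Proof.
  intros Hm Hl.
  pose (J := {t : X * R * nat |
    forall y, cms_d X (fst (fst t)) y < snd (fst t) -> P (snd t) y}).
  destruct (cms_compact X J
    (fun t y => cms_d X (fst (fst (proj1_sig t))) y < snd (fst (proj1_sig t))))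
    as [l Hc].
  - intros t. apply open_ball.
  - intros x. destruct (Hl x) as [r [Hr [N HN]]].
    exists (exist _ (x, r, N) HN). simpl. rewrite cms_d_refl. exact Hr.
  - exists (list_max (map (fun t : J => snd (proj1_sig t)) l)).
    intros x. destruct (Hc x) as [t [Ht Hx]].
    apply Hm with (snd (proj1_sig t)).
    + pose proof (proj1 (list_max_le (map (fun t : J => snd (proj1_sig t)) l) _)
        (le_n _)) as Hle.
      rewrite Forall_forall in Hle. apply Hle. apply in_map_iff. eauto.
    + apply (proj2_sig t). exact Hx.
Qed.

(** A tube argument replaces compactness of the product: for fixed [x], compactness in [y] is
    applied with [N] acting both as the index of [P] and as the inverse radius of a ball around
    [x]. *)
Lemma compact_uniform2 (X : CompactMetricSpace) (P : nat -> X -> X -> Prop) :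
  (forall m n x y, (m <= n)%nat -> P m x y -> P n x y) ->
  (forall x y, exists r, 0 < r /\ exists N, forall x' y',
      cms_d X x x' < r -> cms_d X y y' < r -> P N x' y') ->
  exists N, forall x y, P N x y.
Proof.
  intros Hm Hl.
  apply (compact_uniform X (fun N x => forall y, P N x y)).
  - intros m n x Hmn H y. eauto.
  - intros x.
    destruct (compact_uniform X
      (fun N y => forall x', cms_d X x x' < / (INR N + 1) -> P N x' y)) as [N HN].
    + intros m n y Hmn H x' Hx'. apply Hm with m; auto. apply H.
      pose proof (inv_INR_le m n Hmn). lra.
    + intros y. destruct (Hl x y) as [r [Hr [N HN]]].
      exists r; split; auto. destruct (inv_INR_small r Hr) as [M HM].
      exists (max N M). intros y' Hy' x' Hx'. apply Hm with N; [lia|].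
      apply HN; auto. pose proof (inv_INR_le M (max N M) ltac:(lia)). lra.
    + exists (/ (INR N + 1)). split; [apply inv_INR_pos|].
      exists N. intros x' Hx' y. apply HN, Hx'.
Qed.

Lemma common_radius (X : CompactMetricSpace) (x : X) (P : Z -> X -> Prop) :
  (forall n, exists r, 0 < r /\ forall y, cms_d X x y < r -> P n y) ->
  forall N : nat, exists r, 0 < r /\ forall y, cms_d X x y < r ->
    forall n, (Z.abs n <= Z.of_nat N)%Z -> P n y.
Proof.
  intros H N. induction N as [|N [r [Hr IH]]].
  - destruct (H 0%Z) as [r [Hr HP]]. exists r; split; auto.
    intros y Hy n Hn. replace n with 0%Z by lia. auto.
  - destruct (H (Z.of_nat (S N))) as [r1 [Hr1 H1]].
    destruct (H (- Z.of_nat (S N))%Z) as [r2 [Hr2 H2]].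
    exists (Rmin r (Rmin r1 r2)). split; [repeat apply Rmin_pos; auto|].
    intros y Hy n Hn.
    assert (cms_d X x y < r /\ cms_d X x y < r1 /\ cms_d X x y < r2) as (A & B & C).
    { pose proof (Rmin_l r (Rmin r1 r2)). pose proof (Rmin_r r (Rmin r1 r2)).
      pose proof (Rmin_l r1 r2). pose proof (Rmin_r r1 r2). lra. }
    destruct (Z_le_gt_dec (Z.abs n) (Z.of_nat N)) as [L|G]; [auto|].
    destruct (Z.abs_spec n) as [[_ E]|[_ E]].
    + replace n with (Z.of_nat (S N)) by lia. auto.
    + replace n with (- Z.of_nat (S N))%Z by lia. auto.
Qed.

Lemma iterZ_succ (P : Type) (T Tinv : P -> P) (n : Z) (x : P) :
  (forall y, T (Tinv y) = y) -> iterZ T Tinv (Z.succ n) x = T (iterZ T Tinv n x).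
Proof.
  intros H. destruct n as [|p|p]; [reflexivity| |].
  - change (Z.succ (Z.pos p)) with (Z.pos (p + 1)). rewrite Pos.add_1_r. simpl.
    rewrite Pos2Nat.inj_succ. reflexivity.
  - destruct (Pos.succ_pred_or p) as [->|E]; [simpl; auto|].
    rewrite <- E at 1 2. replace (Z.succ (Z.neg (Pos.succ (Pos.pred p))))
      with (Z.neg (Pos.pred p)) by lia.
    simpl. rewrite Pos2Nat.inj_succ. simpl. rewrite H. reflexivity.
Qed.

Lemma iterZ_pred (P : Type) (T Tinv : P -> P) (n : Z) (x : P) :
  (forall y, T (Tinv y) = y) -> (forall y, Tinv (T y) = y) ->
  iterZ T Tinv (Z.pred n) x = Tinv (iterZ T Tinv n x).
Proof.
  intros H1 H2. rewrite <- (Z.succ_pred n) at 2.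
  rewrite iterZ_succ, H2; auto.
Qed.

Lemma iterZ_add (P : Type) (T Tinv : P -> P) (m n : Z) (x : P) :
  (forall y, T (Tinv y) = y) -> (forall y, Tinv (T y) = y) ->
  iterZ T Tinv (m + n) x = iterZ T Tinv m (iterZ T Tinv n x).
Proof.
  intros H1 H2. induction m as [|m IH|m IH] using Z.peano_ind; [reflexivity| |].
  - rewrite Z.add_succ_l, !iterZ_succ, IH; auto.
  - rewrite Z.add_pred_l, !iterZ_pred, IH; auto.
Qed.

Lemma iterZ_of_nat (P : Type) (T Tinv : P -> P) (n : nat) (x : P) :
  iterZ T Tinv (Z.of_nat n) x = Nat.iter n T x.
Proof. destruct n; [reflexivity|]. simpl. rewrite SuccNat2Pos.id_succ. reflexivity. Qed.

Lemma iterZ_semiconj (P Q : Type) (T Tinv : P -> P) (S Sinv : Q -> Q) (p : P -> Q)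
  (n : Z) (x : P) :
  (forall y, T (Tinv y) = y) -> (forall y, Tinv (T y) = y) ->
  (forall y, S (Sinv y) = y) -> (forall y, Sinv (S y) = y) ->
  (forall y, p (T y) = S (p y)) ->
  p (iterZ T Tinv n x) = iterZ S Sinv n (p x).
Proof.
  intros H1 H2 H3 H4 Hp.
  induction n as [|m IH|m IH] using Z.peano_ind; [reflexivity| |].
  - rewrite !iterZ_succ, Hp, IH; auto.
  - rewrite !iterZ_pred, <- IH; auto. rewrite <- (H4 (p _)), <- Hp, H1. reflexivity.
Qed.

Lemma continuous_iter (X : CompactMetricSpace) (T : X -> X) (n : nat) :
  continuous X X T -> continuous X X (Nat.iter n T).
Proof.
  intros HT. induction n as [|n IH]; intros x e He.
  - exists e; split; auto.
  - destruct (HT (Nat.iter n T x) e He) as [d1 [Hd1 H1]].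
    destruct (IH x d1 Hd1) as [d2 [Hd2 H2]]. exists d2; split; auto.
    intros y Hy. apply H1, H2, Hy.
Qed.

Lemma continuous_iterZ (X : CompactMetricSpace) (T Tinv : X -> X) (n : Z) :
  continuous X X T -> continuous X X Tinv -> continuous X X (iterZ T Tinv n).
Proof.
  intros H1 H2. destruct n; simpl; try (apply continuous_iter; assumption).
  intros x e He. exists e; auto.
Qed.

(** * Uniform [eps]-embeddings *)

Lemma cube_map_unif (X : CompactMetricSpace) (D : nat) (f : X -> nat -> R) (del : R) :
  cube_map X D f -> 0 < del -> exists eps, 0 < eps /\
    forall x y, cms_d X x y < eps -> forall i, (i < D)%nat -> Rabs (f x i - f y i) < del.
Proof.
  intros [_ [_ Hf]] Hd.
  destruct (compact_uniform X (fun N x => forall y, cms_d X x y < / (INR N + 1) ->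
    forall i, (i < D)%nat -> Rabs (f x i - f y i) < del)) as [N HN].
  - intros m n x Hmn H y Hy. apply H. pose proof (inv_INR_le m n Hmn). lra.
  - intros x. destruct (Hf x (del / 2) ltac:(lra)) as [r [Hr H]].
    exists (r / 2). split; [lra|].
    destruct (inv_INR_small (r / 2) ltac:(lra)) as [N HN]. exists N.
    intros y Hy y' Hy' i Hi.
    pose proof (H y ltac:(lra) i Hi) as A1.
    pose proof (cms_d_tri X x y y').
    pose proof (H y' ltac:(lra) i Hi) as A2.
    apply Rabs_def2 in A1, A2. apply Rabs_def1; lra.
  - exists (/ (INR N + 1)). split; [apply inv_INR_pos|exact HN].
Qed.

Lemma I_f_continuous (X : CompactMetricSpace) (T Tinv : X -> X) (D : nat)
  (f : X -> nat -> R) (n : Z) (x : X) (e : R) :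
  continuous X X T -> continuous X X Tinv -> cube_map X D f -> 0 < e ->
  exists r, 0 < r /\ forall y, cms_d X x y < r ->
    forall i, (i < D)%nat -> Rabs (I_f X T Tinv f x n i - I_f X T Tinv f y n i) < e.
Proof.
  intros HT HTi [_ [_ Hf]] He.
  destruct (Hf (iterZ T Tinv n x) e He) as [d1 [Hd1 H1]].
  destruct (continuous_iterZ X T Tinv n HT HTi x d1 Hd1) as [d2 [Hd2 H2]].
  exists d2; split; auto. intros y Hy. apply H1, H2, Hy.
Qed.

(* A uniform version of "[(I_f, pi)] is an [eps]-embedding"; it is visibly open in [f]. *)
Definition unif_embedding (X Zs : CompactMetricSpace) (T Tinv : X -> X) (D : nat)
  (pi : X -> Zs) (eps : R) (f : X -> nat -> R) : Prop :=
  exists N, forall x x',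
    prod_nbhd Zs D N (/ (INR N + 1)) (I_f X T Tinv f x) (pi x) (I_f X T Tinv f x') (pi x') ->
    cms_d X x x' < eps.

(** Near each pair one [N] works: a gap in some coordinate or in [pi] keeps more than a third of its
    size when both points move slightly, and for the other pairs [cms_d X x y < eps] is an open
    condition. *)
Lemma unif_embedding_of_fibers (X Zs : CompactMetricSpace) (T Tinv : X -> X) (D : nat)
  (pi : X -> Zs) (eps : R) (f : X -> nat -> R) :
  continuous X X T -> continuous X X Tinv -> continuous X Zs pi -> cube_map X D f ->
  (forall x x', (forall n i, (i < D)%nat -> I_f X T Tinv f x n i = I_f X T Tinv f x' n i) ->
     pi x = pi x' -> cms_d X x x' < eps) ->
  unif_embedding X Zs T Tinv D pi eps f.
Proof.
  intros HT HTi Hpi Hf H.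
  apply (compact_uniform2 X (fun N x x' =>
    prod_nbhd Zs D N (/ (INR N + 1)) (I_f X T Tinv f x) (pi x) (I_f X T Tinv f x') (pi x') ->
    cms_d X x x' < eps)).
  - intros m n x y Hmn HP [Q1 Q2]. pose proof (inv_INR_le m n Hmn). apply HP. split; [|lra].
    intros k Hk i Hi. pose proof (Q1 k ltac:(lia) i Hi). lra.
  - intros x y.
    destruct (classic (exists n i, (i < D)%nat /\
      I_f X T Tinv f x n i <> I_f X T Tinv f y n i)) as [[n [i [Hi Hne]]]|Heq].
    { set (g := Rabs (I_f X T Tinv f x n i - I_f X T Tinv f y n i)).
      assert (Hg : 0 < g) by (apply Rabs_pos_lt; lra).
      destruct (I_f_continuous X T Tinv D f n x (g / 3) HT HTi Hf ltac:(lra)) as [r1 [Hr1 H1]].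
      destruct (I_f_continuous X T Tinv D f n y (g / 3) HT HTi Hf ltac:(lra)) as [r2 [Hr2 H2]].
      exists (Rmin r1 r2). split; [apply Rmin_pos; auto|].
      destruct (inv_INR_small (g / 3) ltac:(lra)) as [M HM].
      exists (max M (Z.abs_nat n)). intros x' y' Hx Hy [Q _]. exfalso.
      pose proof (Rmin_l r1 r2). pose proof (Rmin_r r1 r2).
      pose proof (H1 x' ltac:(lra) i Hi) as A1. pose proof (H2 y' ltac:(lra) i Hi) as A2.
      pose proof (Q n ltac:(lia) i Hi) as A3.
      pose proof (inv_INR_le M (max M (Z.abs_nat n)) ltac:(lia)).
      apply Rabs_def2 in A1, A2, A3.
      assert (g < g); [|lra]. unfold g at 1. apply Rabs_def1; lra. }
    destruct (classic (pi x = pi y)) as [Hz|Hz].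
    { assert (Hd : cms_d X x y < eps).
      { apply H; auto. intros n i Hi. apply NNPP. intros Hne. apply Heq; eauto. }
      exists ((eps - cms_d X x y) / 2). split; [lra|]. exists 0%nat.
      intros x' y' Hx Hy _.
      pose proof (cms_d_tri X x' x y'). pose proof (cms_d_tri X x y y').
      rewrite (cms_d_sym X x' x) in *. lra. }
    assert (Hg : 0 < cms_d Zs (pi x) (pi y)).
    { destruct (cms_d_nonneg Zs (pi x) (pi y)) as [|E]; auto.
      exfalso. apply Hz, cms_d_eq0; auto. }
    set (g := cms_d Zs (pi x) (pi y)) in *.
    destruct (Hpi x (g / 3) ltac:(lra)) as [r1 [Hr1 H1]].
    destruct (Hpi y (g / 3) ltac:(lra)) as [r2 [Hr2 H2]].
    exists (Rmin r1 r2). split; [apply Rmin_pos; auto|].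
    destruct (inv_INR_small (g / 3) ltac:(lra)) as [M HM].
    exists M. intros x' y' Hx Hy [_ Q]. exfalso.
    pose proof (Rmin_l r1 r2). pose proof (Rmin_r r1 r2).
    pose proof (H1 x' ltac:(lra)) as A1. pose proof (H2 y' ltac:(lra)) as A2.
    pose proof (cms_d_tri Zs (pi x) (pi x') (pi y)) as B.
    pose proof (cms_d_tri Zs (pi x') (pi y') (pi y)).
    rewrite (cms_d_sym Zs (pi y) (pi y')) in A2. fold g in B. lra.
Qed.

Lemma unif_embedding_open (X Zs : CompactMetricSpace) (T Tinv : X -> X) (D : nat)
  (pi : X -> Zs) (eps : R) :
  C_open X D (unif_embedding X Zs T Tinv D pi eps).
Proof.
  intros f _ [N HN].
  pose proof (inv_INR_pos N) as HN0. pose proof (pos_INR N).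
  exists (/ (INR N + 1) / 3). split; [lra|].
  (* This index makes the tolerance exactly a third of [/ (INR N + 1)]; the other two thirds pay for
     exchanging [g] and [f] at [x] and at [x']. *)
  intros g _ [r [Hr Hfg]]. exists (3 * N + 2)%nat.
  intros x x' [Q1 Q2].
  assert (E : / (INR (3 * N + 2) + 1) = / (INR N + 1) / 3).
  { rewrite plus_INR, mult_INR. simpl. field. lra. }
  rewrite E in Q1, Q2. apply HN. split; [|lra].
  intros n Hn i Hi. pose proof (Q1 n ltac:(lia) i Hi) as A.
  pose proof (Hfg (iterZ T Tinv n x) i Hi) as B.
  pose proof (Hfg (iterZ T Tinv n x') i Hi) as C.
  unfold I_f in *. apply Rabs_def2 in A.
  assert (B' := Rle_lt_trans _ _ _ B Hr). assert (C' := Rle_lt_trans _ _ _ C Hr).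
  apply Rabs_def2 in B', C'. apply Rabs_def1; lra.
Qed.

(** The same uniform [N] gives both injectivity, by letting [k] grow, and continuity of the inverse
    on the image. *)
Lemma embedding_of_unif (X Zs : CompactMetricSpace) (T Tinv : X -> X) (D : nat)
  (pi : X -> Zs) (f : X -> nat -> R) :
  continuous X X T -> continuous X X Tinv -> continuous X Zs pi -> cube_map X D f ->
  (forall k, unif_embedding X Zs T Tinv D pi (/ (INR k + 1)) f) ->
  embedding_pair X Zs T Tinv D f pi.
Proof.
  intros HT HTi Hpi Hf H. split; [|split].
  - intros x N e He.
    destruct (common_radius X x (fun n y => forall i, (i < D)%nat ->
      Rabs (I_f X T Tinv f x n i - I_f X T Tinv f y n i) < e)
      (fun n => I_f_continuous X T Tinv D f n x e HT HTi Hf He) N) as [r1 [Hr1 H1]].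
    destruct (Hpi x e He) as [r2 [Hr2 H2]].
    exists (Rmin r1 r2). split; [apply Rmin_pos; auto|].
    intros y Hy. pose proof (Rmin_l r1 r2). pose proof (Rmin_r r1 r2).
    split; [apply H1; lra|apply H2; lra].
  - intros x x' Heq Hz. apply cms_d_eq0.
    destruct (cms_d_nonneg X x x') as [Hp|E]; auto. exfalso.
    destruct (inv_INR_small _ Hp) as [k Hk]. destruct (H k) as [N HN].
    enough (cms_d X x x' < / (INR k + 1)) by lra.
    apply HN. pose proof (inv_INR_pos N). split.
    + intros n _ i Hi. rewrite (Heq n i Hi), Rminus_diag, Rabs_R0. auto.
    + rewrite Hz, cms_d_refl. auto.
  - intros x eps Heps. destruct (inv_INR_small _ Heps) as [k Hk]. destruct (H k) as [N HN].
    exists N, (/ (INR N + 1)). split; [apply inv_INR_pos|].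
    intros x' Q. pose proof (HN x x' Q). lra.
Qed.

(** * The Baire category theorem for cube-valued maps *)

(** Nested closed balls, recorded as a centre with a radius. The limit is taken pointwise, and its
    distance to each centre is at most the radius there, so it is a continuous map lying in every
    ball. *)
Lemma baire_cube (X : CompactMetricSpace) (D : nat) (U : nat -> (X -> nat -> R) -> Prop) :
  (forall k, C_open X D (U k)) -> (forall k, C_dense X D (U k)) ->
  exists f, cube_map X D f /\ forall k, U k f.
Proof.
  intros Ho Hd.
  pose (St := {p : (X -> nat -> R) * R | cube_map X D (fst p) /\ 0 < snd p}).
  pose (fn := fun s : St => fst (proj1_sig s)). pose (rad := fun s : St => snd (proj1_sig s)).
  assert (Hstep : forall ks : nat * St, exists s' : St,
    rad s' <= rad (snd ks) / 2 /\
    (forall x i, (i < D)%nat -> Rabs (fn s' x i - fn (snd ks) x i) <= rad (snd ks) / 2) /\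
    (forall g, cube_map X D g ->
       (forall x i, (i < D)%nat -> Rabs (fn s' x i - g x i) <= rad s') -> U (fst ks) g)).
  { intros [k [[f e] [Hf He]]]. simpl in *.
    destruct (Hd k f Hf (e / 2) ltac:(lra)) as [g [Hg [Ug [r [Hr Hfg]]]]].
    destruct (Ho k g Hg Ug) as [e' [He' HU]].
    assert (Hm : 0 < Rmin (e' / 2) (e / 2)) by (apply Rmin_pos; lra).
    (* The bound [e' / 2] puts the closed ball inside the open ball on which [U k] holds; [e / 2],
       together with a displacement of at most [e / 2], keeps it inside the previous ball. *)
    exists (exist _ (g, Rmin (e' / 2) (e / 2)) (conj Hg Hm)).
    unfold fn, rad; simpl. split; [apply Rmin_r|split].
    - intros x i Hi. rewrite Rabs_minus_sym. pose proof (Hfg x i Hi). lra.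
    - intros h Hh Hgh. apply HU; auto. exists (Rmin (e' / 2) (e / 2)).
      pose proof (Rmin_l (e' / 2) (e / 2)). split; [lra|auto]. }
  destruct (functional_choice _ _ _ Hstep) as [step Hst]. clear Hstep.
  assert (H0 : cube_map X D (fun _ _ => 0) /\ 0 < 1).
  { split; [|lra]. split; [intros; lra|split; [reflexivity|]].
    intros x e He. exists 1. split; [lra|]. intros.
    rewrite Rminus_diag, Rabs_R0. auto. }
  pose (s := fix s (n : nat) : St := match n with
     | O => exist _ (fun _ _ => 0, 1) H0
     | S k => step (k, s k) end).
  assert (Hpos : forall n, 0 < rad (s n)) by (intros n; exact (proj2 (proj2_sig (s n)))).
  assert (Hcube : forall n, cube_map X D (fn (s n))) by (intros n; exact (proj1 (proj2_sig (s n)))).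
  assert (Hhalf : forall n, rad (s (S n)) <= rad (s n) / 2) by (intros n; apply (Hst (n, s n))).
  (* Each step moves the centre by at most half the radius, which is at most the loss of radius, so
     the displacements telescope. *)
  assert (Hclose : forall n m x i, Rabs (fn (s (n + m)%nat) x i - fn (s n) x i)
            <= rad (s n) - rad (s (n + m)%nat)).
  { intros n m x i. induction m as [|m IH].
    - rewrite Nat.add_0_r, !Rminus_diag, Rabs_R0. lra.
    - rewrite Nat.add_succ_r.
      assert (A : Rabs (fn (s (S (n + m))) x i - fn (s (n + m)%nat) x i) <= rad (s (n + m)%nat) / 2).
      { destruct (le_lt_dec D i) as [Hi|Hi].
        - rewrite (proj1 (proj2 (Hcube (S (n + m)))) x i Hi),
            (proj1 (proj2 (Hcube (n + m)%nat)) x i Hi), Rminus_diag, Rabs_R0.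
          pose proof (Hpos (n + m)%nat); lra.
        - apply (Hst ((n + m)%nat, s (n + m)%nat)); auto. }
      pose proof (Hhalf (n + m)%nat).
      replace (fn (s (S (n + m))) x i - fn (s n) x i) with
        ((fn (s (S (n + m))) x i - fn (s (n + m)%nat) x i)
          + (fn (s (n + m)%nat) x i - fn (s n) x i)) by ring.
      eapply Rle_trans; [apply Rabs_triang|]. lra. }
  assert (Hrad : forall e, 0 < e -> exists n, rad (s n) < e).
  { intros e He.
    assert (Hb : forall n, rad (s n) <= (/ 2) ^ n).
    { induction n as [|n IHn]; [apply Rle_refl|]. pose proof (Hhalf n). simpl pow. lra. }
    destruct (pow_lt_1_zero (/ 2) ltac:(rewrite Rabs_pos_eq; lra) e He) as [n Hn].
    exists n. pose proof (Hb n). pose proof (Hn n (le_n _)) as B.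
    apply Rabs_def2 in B. lra. }
  assert (Hlim : forall xi : X * nat, exists y,
    Un_cv (fun n => fn (s n) (fst xi) (snd xi)) y).
  { intros [x i]; simpl. enough (C : Cauchy_crit (fun n => fn (s n) x i)).
    { destruct (R_complete _ C) as [y Hy]. eauto. }
    intros e He. destruct (Hrad (e / 2) ltac:(lra)) as [N HN]. exists N.
    intros n m Hn Hm. unfold Rdist.
    pose proof (Hclose N (n - N)%nat x i) as A. pose proof (Hclose N (m - N)%nat x i) as B.
    replace (N + (n - N))%nat with n in A by lia. replace (N + (m - N))%nat with m in B by lia.
    pose proof (Hpos n). pose proof (Hpos m).
    assert (A' : Rabs (fn (s n) x i - fn (s N) x i) < e / 2) by lra.
    assert (B' : Rabs (fn (s m) x i - fn (s N) x i) < e / 2) by lra.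
    apply Rabs_def2 in A', B'. apply Rabs_def1; lra. }
  destruct (functional_choice _ _ _ Hlim) as [g Hg]. clear Hlim.
  assert (Hgn : forall n x i, Rabs (fn (s n) x i - g (x, i)) <= rad (s n)).
  { intros n x i. apply Rnot_lt_le. intros Hlt.
    set (gap := Rabs (fn (s n) x i - g (x, i)) - rad (s n)).
    destruct (Hg (x, i) gap ltac:(unfold gap; lra)) as [N HN]. simpl in HN.
    pose proof (HN (n + N)%nat ltac:(lia)) as A. unfold Rdist in A.
    pose proof (Hclose n N x i) as B. pose proof (Hpos (n + N)%nat).
    pose proof (Rabs_triang (fn (s n) x i - fn (s (n + N)%nat) x i)
      (fn (s (n + N)%nat) x i - g (x, i))) as C.
    rewrite (Rabs_minus_sym (fn (s n) x i) (fn (s (n + N)%nat) x i)) in C.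
    replace (fn (s n) x i - fn (s (n + N)%nat) x i + (fn (s (n + N)%nat) x i - g (x, i)))
      with (fn (s n) x i - g (x, i)) in C by ring.
    unfold gap in A. lra. }
  assert (Hgc : cube_map X D (fun x i => g (x, i))).
  { split; [|split].
    - intros x i Hi.
      assert (A : forall e, 0 < e -> - e <= g (x, i) <= 1 + e).
      { intros e He. destruct (Hrad e He) as [n Hn].
        pose proof (Rle_lt_trans _ _ _ (Hgn n x i) Hn) as B. apply Rabs_def2 in B.
        pose proof (proj1 (Hcube n) x i Hi). lra. }
      split; apply Rnot_lt_le; intros Hlt.
      + pose proof (A (- g (x, i) / 2) ltac:(lra)). lra.
      + pose proof (A ((g (x, i) - 1) / 2) ltac:(lra)). lra.
    - intros x i Hi. apply cond_eq. intros e He. destruct (Hrad e He) as [n Hn].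
      pose proof (Rle_lt_trans _ _ _ (Hgn n x i) Hn) as B.
      rewrite (proj1 (proj2 (Hcube n)) x i Hi) in B. rewrite Rabs_minus_sym. exact B.
    - intros x e He. destruct (Hrad (e / 3) ltac:(lra)) as [n Hn].
      destruct (proj2 (proj2 (Hcube n)) x (e / 3) ltac:(lra)) as [del [Hdel HH]].
      exists del; split; auto. intros x' Hx' i Hi.
      pose proof (HH x' Hx' i Hi) as A.
      pose proof (Rle_lt_trans _ _ _ (Hgn n x i) Hn) as B.
      pose proof (Rle_lt_trans _ _ _ (Hgn n x' i) Hn) as C.
      apply Rabs_def2 in A, B, C. apply Rabs_def1; lra. }
  exists (fun x i => g (x, i)). split; auto.
  intros k. apply (Hst (k, s k)); auto.
  intros x i _. exact (Hgn (S k) x i).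
Qed.

(** * Clopen marker sets and their blocks *)

(** Clopenness in pointwise form: Boolean combinations and preimages then reduce to taking minima of
    radii. *)
Definition loc_const (X : CompactMetricSpace) (A : X -> Prop) : Prop :=
  forall x, exists r, 0 < r /\ forall y, cms_d X x y < r -> (A y <-> A x).

Lemma clopen_loc_const (X : CompactMetricSpace) (A : X -> Prop) :
  clopen X A -> loc_const X A.
Proof.
  intros [H1 H2] x. destruct (classic (A x)) as [Hx|Hx].
  - destruct (H1 x Hx) as [r [Hr H]]. exists r; split; auto.
    intros y Hy. split; auto.
  - destruct (H2 x Hx) as [r [Hr H]]. exists r; split; auto.
    intros y Hy. specialize (H y Hy). tauto.
Qed.

Lemma loc_const_comp (X Y : CompactMetricSpace) (A : Y -> Prop) (h : X -> Y) :
  continuous X Y h -> loc_const Y A -> loc_const X (fun x => A (h x)).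
Proof.
  intros Hh HA x. destruct (HA (h x)) as [r [Hr H]].
  destruct (Hh x r Hr) as [r' [Hr' H']]. exists r'; split; auto.
Qed.

Lemma loc_const_iterZ_common (Zs : CompactMetricSpace) (S Sinv : Zs -> Zs)
  (W : Zs -> Prop) (N : nat) (z : Zs) :
  is_homeo Zs S Sinv -> loc_const Zs W ->
  exists r, 0 < r /\ forall w, cms_d Zs z w < r -> forall n,
    (Z.abs n <= Z.of_nat N)%Z -> (W (iterZ S Sinv n w) <-> W (iterZ S Sinv n z)).
Proof.
  intros [HS [HSi _]] HW.
  apply (common_radius Zs z (fun n w => W (iterZ S Sinv n w) <-> W (iterZ S Sinv n z))).
  intros n.
  exact (loc_const_comp Zs Zs W _ (continuous_iterZ Zs S Sinv n HS HSi) HW z).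
Qed.

(** Aperiodicity puts [z] at a distance [r > 0] from its iterate [h z]. If [w] and [h w] both lie in
    a small enough clopen neighbourhood of [z], then [h w] is within [r / 2] of both [z] and [h z],
    a contradiction. The induction excludes one time after the other. *)
Lemma local_marker (Zs : CompactMetricSpace) (S Sinv : Zs -> Zs) (z : Zs) (n : nat) :
  is_homeo Zs S Sinv -> aperiodic Zs S -> zero_dim Zs ->
  exists V : Zs -> Prop, loc_const Zs V /\ V z /\
    forall w i, (0 < i <= Z.of_nat n)%Z -> V w -> ~ V (iterZ S Sinv i w).
Proof.
  intros hS hap hzd. induction n as [|n (V & HV & Vz & HVd)].
  { exists (fun _ => True). split; [|split; [exact I|lia]].
    intros x. exists 1. split; [lra|tauto]. }
  set (h := iterZ S Sinv (Z.of_nat (1 + n))).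
  assert (Hh : continuous Zs Zs h) by (apply continuous_iterZ; apply hS).
  assert (Hr : 0 < cms_d Zs z (h z)).
  { destruct (cms_d_nonneg Zs z (h z)) as [|E]; auto. exfalso.
    apply (hap z (1 + n)%nat ltac:(lia)). rewrite <- (iterZ_of_nat _ S Sinv).
    symmetry. apply cms_d_eq0. auto. }
  set (r := cms_d Zs z (h z)) in *.
  destruct (Hh z (r / 2) ltac:(lra)) as [r' [Hr' H']].
  destruct (hzd (fun w => cms_d Zs z w < Rmin (r / 2) r') z) as (V' & HV' & V'z & HV'd).
  { apply open_ball. }
  { rewrite cms_d_refl. apply Rmin_pos; lra. }
  apply clopen_loc_const in HV'.
  exists (fun w => V w /\ V' w). split; [|split; [auto|]].
  - intros x. destruct (HV x) as [r1 [Hr1 H1]]. destruct (HV' x) as [r2 [Hr2 H2]].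
    exists (Rmin r1 r2). split; [apply Rmin_pos; auto|]. intros y Hy.
    pose proof (Rmin_l r1 r2). pose proof (Rmin_r r1 r2).
    rewrite (H1 y), (H2 y); lra || tauto.
  - intros w i Hi [Vw V'w] [Vi V'i].
    destruct (Z.eq_dec i (Z.of_nat (1 + n))) as [->|Hne].
    + apply HV'd in V'w, V'i. fold h in V'i.
      pose proof (Rmin_l (r / 2) r'). pose proof (Rmin_r (r / 2) r').
      pose proof (H' w ltac:(lra)) as A.
      pose proof (cms_d_tri Zs z (h w) (h z)) as B.
      rewrite (cms_d_sym Zs (h w)) in B. fold r in B. lra.
    + apply (HVd w i); auto. lia.
Qed.

(** Greedy choice along a finite cover by local markers: from each [V] only those points are added
    whose whole window of radius [N] avoids the set built so far. The window is two-sided, so old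
    and new points cannot conflict in either order; two new points cannot conflict because both lie
    in [V]; a rejected point of [V] already sees the set within its window. *)
Lemma marker_set (Zs : CompactMetricSpace) (S Sinv : Zs -> Zs) (N : nat) :
  is_homeo Zs S Sinv -> aperiodic Zs S -> zero_dim Zs ->
  exists W : Zs -> Prop, loc_const Zs W /\
    (forall z i, (0 < i <= Z.of_nat N)%Z -> W z -> ~ W (iterZ S Sinv i z)) /\
    (forall z, exists i, (Z.abs i <= Z.of_nat N)%Z /\ W (iterZ S Sinv i z)).
Proof.
  intros hS hap hzd.
  pose (good := fun V : Zs -> Prop => loc_const Zs V /\
    forall w i, (0 < i <= Z.of_nat N)%Z -> V w -> ~ V (iterZ S Sinv i w)).
  assert (Hadd : forall m n z, iterZ S Sinv m (iterZ S Sinv n z) = iterZ S Sinv (m + n) z).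
  { intros m n z. symmetry. apply iterZ_add; apply hS. }
  assert (Hlist : forall l : list {V | good V}, exists W, good W /\
    forall z V, In V l -> proj1_sig V z ->
      exists i, (Z.abs i <= Z.of_nat N)%Z /\ W (iterZ S Sinv i z)).
  { intros l. induction l as [|[V [HV HVd]] l (W & [HW HWd] & HWc)].
    { exists (fun _ => False). split; [split|].
      - intros x. exists 1. split; [lra|tauto].
      - tauto.
      - intros z V []. }
    pose (new := fun z => V z /\
      forall i, (Z.abs i <= Z.of_nat N)%Z -> ~ W (iterZ S Sinv i z)).
    exists (fun z => W z \/ new z). split; [split|].
    - intros z.
      destruct (loc_const_iterZ_common Zs S Sinv W N z hS HW) as [r1 [Hr1 H1]].
      destruct (HV z) as [r2 [Hr2 H2]].
      exists (Rmin r1 r2). split; [apply Rmin_pos; auto|]. intros w Hw.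
      pose proof (Rmin_l r1 r2). pose proof (Rmin_r r1 r2).
      specialize (H1 w ltac:(lra)). specialize (H2 w ltac:(lra)).
      pose proof (H1 0%Z ltac:(lia)) as HW0. simpl in HW0.
      assert (Hnew : new w <-> new z).
      { unfold new. rewrite H2. split; intros [Hv Hi]; split; auto;
          intros i Hle; specialize (Hi i Hle); specialize (H1 i Hle); tauto. }
      tauto.
    - intros w i Hi [A|[A1 A2]] [B|[B1 B2]].
      + apply (HWd w i); auto.
      + apply (B2 (- i)%Z ltac:(lia)). rewrite Hadd.
        replace (- i + i)%Z with 0%Z by lia. exact A.
      + apply (A2 i); [lia|auto].
      + apply (HVd w i); auto.
    - intros z V' [<-|HV'] Hz.
      + simpl in Hz. destruct (classic (new z)) as [Hn|Hn].
        { exists 0%Z. split; [lia|]. right; exact Hn. }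
        apply NNPP. intros Hno. apply Hn. split; auto.
        intros i Hi Hw. apply Hno. eauto.
      + destruct (HWc z V' HV' Hz) as [i [Hi Hw]]. eauto. }
  destruct (cms_compact Zs {V | good V} (fun V => proj1_sig V)) as [l Hl].
  - intros [V [HV HVd]] z Hz. simpl in *. destruct (HV z) as [r [Hr H]].
    exists r; split; auto. intros y Hy. apply H; auto.
  - intros z. destruct (local_marker Zs S Sinv z N hS hap hzd) as (V & HV & Vz & HVd).
    exists (exist _ V (conj HV HVd)). exact Vz.
  - destruct (Hlist l) as (W & [HW HWd] & HWc). exists W. split; [auto|split; [auto|]].
    intros z. destruct (Hl z) as [V [HV Hz]]. eauto.
Qed.

(* [-a] and [b] are the consecutive times [-a <= 0 < b] at which the orbit of [z] visits [W]. *)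
Definition marker_block (Zs : CompactMetricSpace) (S Sinv : Zs -> Zs) (W : Zs -> Prop)
  (z : Zs) (a b : nat) : Prop :=
  (0 < b)%nat /\ W (iterZ S Sinv (- Z.of_nat a) z) /\ W (iterZ S Sinv (Z.of_nat b) z) /\
  forall t, (- Z.of_nat a < t < Z.of_nat b)%Z -> ~ W (iterZ S Sinv t z).

Lemma least_nat (P : nat -> Prop) (n : nat) :
  P n -> exists m, P m /\ forall k, (k < m)%nat -> ~ P k.
Proof.
  induction n as [n IH] using lt_wf_ind. intros Hn.
  destruct (classic (exists k, (k < n)%nat /\ P k)) as [[k [Hk Pk]]|H].
  - apply (IH k); auto.
  - exists n. split; auto. intros k Hk Pk. apply H. eauto.
Qed.

Lemma marker_block_exists (Zs : CompactMetricSpace) (S Sinv : Zs -> Zs) (W : Zs -> Prop)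
  (N : nat) (z : Zs) :
  is_homeo Zs S Sinv ->
  (forall z, exists i, (Z.abs i <= Z.of_nat N)%Z /\ W (iterZ S Sinv i z)) ->
  exists a b, marker_block Zs S Sinv W z a b.
Proof.
  intros hS HW.
  assert (Hadd : forall m n z, iterZ S Sinv m (iterZ S Sinv n z) = iterZ S Sinv (m + n) z).
  { intros m n w. symmetry. apply iterZ_add; apply hS. }
  (* The window of radius [N] around time [-N] contains only times at most 0, and the one around
     [N + 1] only positive times. *)
  assert (Ha : exists a : nat, W (iterZ S Sinv (- Z.of_nat a) z)).
  { destruct (HW (iterZ S Sinv (- Z.of_nat N) z)) as [i [Hi H]]. rewrite Hadd in H.
    exists (Z.to_nat (Z.of_nat N - i)). rewrite Z2Nat.id by lia.
    replace (- (Z.of_nat N - i))%Z with (i + - Z.of_nat N)%Z by lia. exact H. }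
  assert (Hb : exists b : nat, (0 < b)%nat /\ W (iterZ S Sinv (Z.of_nat b) z)).
  { destruct (HW (iterZ S Sinv (Z.of_nat N + 1) z)) as [i [Hi H]]. rewrite Hadd in H.
    exists (Z.to_nat (i + (Z.of_nat N + 1))). rewrite Z2Nat.id by lia. split; [lia|exact H]. }
  destruct Ha as [a0 Ha0]. destruct (least_nat (fun a => W (iterZ S Sinv (- Z.of_nat a) z)) a0 Ha0) as [a [Ha Hamin]].
  destruct Hb as [b0 Hb0]. destruct (least_nat (fun b => (0 < b)%nat /\ W (iterZ S Sinv (Z.of_nat b) z)) b0 Hb0) as [b [[Hb0' Hb] Hbmin]].
  exists a, b. split; [auto|split; [auto|split; [auto|]]].
  intros t Ht Hw. destruct (Z_le_gt_dec t 0) as [L|G].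
  - apply (Hamin (Z.to_nat (- t))); [lia|]. rewrite Z2Nat.id by lia.
    rewrite Z.opp_involutive. exact Hw.
  - apply (Hbmin (Z.to_nat t)); [lia|]. rewrite Z2Nat.id by lia. split; [lia|exact Hw].
Qed.

Lemma marker_block_unique (Zs : CompactMetricSpace) (S Sinv : Zs -> Zs) (W : Zs -> Prop)
  (z : Zs) (a b a' b' : nat) :
  marker_block Zs S Sinv W z a b -> marker_block Zs S Sinv W z a' b' -> a = a' /\ b = b'.
Proof.
  intros (H1 & H2 & H3 & H4) (K1 & K2 & K3 & K4).
  split.
  - destruct (lt_eq_lt_dec a a') as [[L|E]|G]; auto; exfalso.
    + apply (K4 (- Z.of_nat a)%Z); auto; lia.
    + apply (H4 (- Z.of_nat a')%Z); auto; lia.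
  - destruct (lt_eq_lt_dec b b') as [[L|E]|G]; auto; exfalso.
    + apply (K4 (Z.of_nat b)%Z); auto; lia.
    + apply (H4 (Z.of_nat b')%Z); auto; lia.
Qed.

(** Seen from any of its times, a block has the same total length [a + b], so one and the same block
    map is read off along all of it. *)
Lemma marker_block_shift (Zs : CompactMetricSpace) (S Sinv : Zs -> Zs) (W : Zs -> Prop)
  (z : Zs) (a b t : nat) :
  is_homeo Zs S Sinv -> marker_block Zs S Sinv W z a b -> (t < a + b)%nat ->
  marker_block Zs S Sinv W (iterZ S Sinv (Z.of_nat t - Z.of_nat a) z) t (a + b - t).
Proof.
  intros hS (H1 & H2 & H3 & H4) Ht.
  assert (Hadd : forall m n z, iterZ S Sinv m (iterZ S Sinv n z) = iterZ S Sinv (m + n) z).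
  { intros m n w. symmetry. apply iterZ_add; apply hS. }
  split; [lia|split; [|split]].
  - rewrite Hadd. replace (- Z.of_nat t + (Z.of_nat t - Z.of_nat a))%Z
      with (- Z.of_nat a)%Z by lia. exact H2.
  - rewrite Hadd. replace (Z.of_nat (a + b - t) + (Z.of_nat t - Z.of_nat a))%Z
      with (Z.of_nat b) by lia. exact H3.
  - intros u Hu. rewrite Hadd. apply H4. lia.
Qed.

Lemma marker_block_local (Zs : CompactMetricSpace) (S Sinv : Zs -> Zs) (W : Zs -> Prop)
  (z : Zs) (a b : nat) :
  is_homeo Zs S Sinv -> loc_const Zs W -> marker_block Zs S Sinv W z a b ->
  exists r, 0 < r /\ forall w, cms_d Zs z w < r -> marker_block Zs S Sinv W w a b.
Proof.
  intros hS HW (H1 & H2 & H3 & H4).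
  destruct (loc_const_iterZ_common Zs S Sinv W (a + b) z hS HW) as [r [Hr H]].
  exists r; split; auto. intros w Hw. specialize (H w Hw).
  split; [auto|split; [|split]].
  - apply H; [lia|auto].
  - apply H; [lia|auto].
  - intros t Ht. rewrite (H t) by lia. auto.
Qed.

Lemma marker_block_length (Zs : CompactMetricSpace) (S Sinv : Zs -> Zs) (W : Zs -> Prop)
  (N : nat) (z : Zs) (a b : nat) :
  is_homeo Zs S Sinv ->
  (forall z i, (0 < i <= Z.of_nat N)%Z -> W z -> ~ W (iterZ S Sinv i z)) ->
  marker_block Zs S Sinv W z a b -> (N < a + b)%nat.
Proof.
  intros hS HW (H1 & H2 & H3 & H4). apply Nat.nle_gt. intros Hle.
  apply (HW _ (Z.of_nat (a + b)) ltac:(lia) H2).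
  rewrite <- iterZ_add by apply hS.
  replace (Z.of_nat (a + b) + - Z.of_nat a)%Z with (Z.of_nat b) by lia. exact H3.
Qed.

(** * Finite sums, real continuous functions and partitions of unity *)

Lemma rsum_ext (n : nat) (g h : nat -> R) :
  (forall a, (a < n)%nat -> g a = h a) -> rsum n g = rsum n h.
Proof.
  intros H. induction n as [|n IH]; simpl; [reflexivity|].
  rewrite IH by (intros; apply H; lia). rewrite H by lia. reflexivity.
Qed.

Lemma rsum_minus (n : nat) (g h : nat -> R) :
  rsum n (fun a => g a - h a) = rsum n g - rsum n h.
Proof. induction n as [|n IH]; simpl; [ring|]. rewrite IH. ring. Qed.

Lemma rsum_mult_r (n : nat) (g : nat -> R) (c : R) :
  rsum n (fun a => g a * c) = rsum n g * c.
Proof. induction n as [|n IH]; simpl; [ring|]. rewrite IH. ring. Qed.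

Lemma rsum_le (n : nat) (g h : nat -> R) :
  (forall a, (a < n)%nat -> g a <= h a) -> rsum n g <= rsum n h.
Proof.
  intros H. induction n as [|n IH]; simpl; [lra|].
  pose proof (H n ltac:(lia)). assert (rsum n g <= rsum n h) by (apply IH; intros; apply H; lia).
  lra.
Qed.

Lemma rsum_zero (n : nat) (g : nat -> R) :
  (forall a, (a < n)%nat -> g a = 0) -> rsum n g = 0.
Proof.
  intros H. induction n as [|n IH]; simpl; [reflexivity|].
  rewrite IH, H by (intros; try apply H; lia). ring.
Qed.

Lemma rsum_pos (n a : nat) (g : nat -> R) :
  (forall b, (b < n)%nat -> 0 <= g b) -> (a < n)%nat -> 0 < g a -> 0 < rsum n g.
Proof.
  intros H Ha Hg. induction n as [|n IH]; simpl; [lia|].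
  assert (Hn : 0 <= rsum n g).
  { rewrite <- (rsum_zero n (fun _ => 0)) by reflexivity. apply rsum_le. intros; apply H; lia. }
  pose proof (H n ltac:(lia)).
  destruct (Nat.eq_dec a n) as [->|Hne]; [lra|].
  assert (0 < rsum n g); [|lra]. apply IH; [intros; apply H|]; lia.
Qed.

Definition contR (X : CompactMetricSpace) (g : X -> R) : Prop :=
  forall x e, 0 < e -> exists del, 0 < del /\
    forall y, cms_d X x y < del -> Rabs (g x - g y) < e.

Lemma contR_const (X : CompactMetricSpace) (c : R) : contR X (fun _ => c).
Proof.
  intros x e He. exists 1. split; [lra|]. intros. rewrite Rminus_diag, Rabs_R0. exact He.
Qed.

Lemma contR_plus (X : CompactMetricSpace) (g h : X -> R) :
  contR X g -> contR X h -> contR X (fun x => g x + h x).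
Proof.
  intros Hg Hh x e He.
  destruct (Hg x (e / 2) ltac:(lra)) as [r1 [Hr1 H1]].
  destruct (Hh x (e / 2) ltac:(lra)) as [r2 [Hr2 H2]].
  exists (Rmin r1 r2). split; [apply Rmin_pos; auto|]. intros y Hy.
  pose proof (Rmin_l r1 r2). pose proof (Rmin_r r1 r2).
  pose proof (H1 y ltac:(lra)) as A. pose proof (H2 y ltac:(lra)) as B.
  apply Rabs_def2 in A, B. apply Rabs_def1; lra.
Qed.

Lemma contR_comp (X : CompactMetricSpace) (g : X -> R) (F : R -> R) :
  contR X g -> (forall x, continuity_pt F (g x)) -> contR X (fun x => F (g x)).
Proof.
  intros Hg HF x e He. destruct (HF x e He) as [al [Hal H]].
  destruct (Hg x al Hal) as [del [Hdel H']]. exists del; split; auto. intros y Hy.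
  (* [continuity_pt] is a limit over a punctured neighbourhood, so equal values are treated
     apart. *)
  destruct (Req_dec (g y) (g x)) as [->|Hne].
  - rewrite Rminus_diag, Rabs_R0. exact He.
  - rewrite Rabs_minus_sym. apply H. split.
    + split; [exact I|auto].
    + simpl. unfold Rdist. rewrite Rabs_minus_sym. auto.
Qed.

Lemma contR_scal (X : CompactMetricSpace) (g : X -> R) (c : R) :
  contR X g -> contR X (fun x => c * g x).
Proof.
  intros Hg. apply (contR_comp X g (fun y => c * y)); auto. intros x.
  apply derivable_continuous_pt. reg.
Qed.

Lemma contR_mult (X : CompactMetricSpace) (g h : X -> R) :
  contR X g -> contR X h -> contR X (fun x => g x * h x).
Proof.
  intros Hg Hh.
  (* Polarization, [g h = ((g + h)^2 - (g - h)^2) / 4], reduces the product to a function of one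
     variable. *)
  assert (Hsq : forall k, contR X k -> contR X (fun x => Rsqr (k x))).
  { intros k Hk. apply contR_comp; auto. intros x. apply derivable_continuous_pt. reg. }
  pose proof (contR_plus X _ _ Hg Hh) as H1.
  pose proof (contR_plus X _ _ Hg (contR_scal X h (-1) Hh)) as H2.
  pose proof (contR_plus X _ _ (contR_scal X _ (/ 4) (Hsq _ H1))
    (contR_scal X _ (- / 4) (Hsq _ H2))) as H3.
  intros x e He. destruct (H3 x e He) as [del [Hdel H]]. exists del; split; auto.
  intros y Hy. specialize (H y Hy). unfold Rsqr in H.
  match type of H with Rabs ?u < _ => replace (g x * h x - g y * h y) with u by field end.
  exact H.
Qed.

Lemma contR_inv (X : CompactMetricSpace) (g : X -> R) :
  contR X g -> (forall x, g x <> 0) -> contR X (fun x => / g x).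
Proof.
  intros Hg Hn. apply contR_comp; auto. intros x.
  apply (continuity_pt_inv id (g x)); [apply derivable_continuous_pt; reg|apply Hn].
Qed.

Lemma contR_bump (X : CompactMetricSpace) (z : X) (r : R) :
  contR X (fun x => Rmax 0 (r - cms_d X z x)).
Proof.
  intros x e He. exists e; split; auto. intros y Hy.
  pose proof (cms_d_tri X z x y). pose proof (cms_d_tri X z y x).
  rewrite (cms_d_sym X y x) in *.
  unfold Rmax. destruct (Rle_dec 0 (r - cms_d X z x)), (Rle_dec 0 (r - cms_d X z y));
    apply Rabs_def1; lra.
Qed.

Lemma contR_rsum (X : CompactMetricSpace) (n : nat) (g : nat -> X -> R) :
  (forall a, contR X (g a)) -> contR X (fun x => rsum n (fun a => g a x)).
Proof.
  intros H. induction n as [|n IH]; simpl; [apply contR_const|].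
  apply contR_plus; auto.
Qed.

(** All bumps belonging to one member of the cover are added into one function. This makes [s]
    injective on the indices below [L], as the order of a cover counts distinct members. *)
Lemma partition_of_unity (X : CompactMetricSpace) (I : Type) (i0 : I) (U : I -> X -> Prop) :
  (forall i, d_open (cms_d X) (U i)) -> (forall x, exists i, U i x) ->
  exists (L : nat) (s : nat -> I) (phi : nat -> X -> R),
    (forall a b, (a < L)%nat -> (b < L)%nat -> s a = s b -> a = b) /\
    (forall a, contR X (phi a)) /\
    (forall a x, 0 <= phi a x) /\
    (forall a x, phi a x <> 0 -> U (s a) x) /\
    (forall x, rsum L (fun a => phi a x) = 1).
Proof.
  intros Ho Hc.
  assert (eqI : forall i j : I, {i = j} + {i <> j})
    by (intros; apply excluded_middle_informative).
  pose (J := {t : X * R * I |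
    forall y, cms_d X (fst (fst t)) y < snd (fst t) -> U (snd t) y}).
  pose (ctr := fun t : J => fst (fst (proj1_sig t))).
  pose (rad := fun t : J => snd (fst (proj1_sig t))).
  pose (ind := fun t : J => snd (proj1_sig t)).
  destruct (cms_compact X J (fun t y => cms_d X (ctr t) y < rad t)) as [l Hl].
  { intros t. apply open_ball. }
  { intros x. destruct (Hc x) as [i Hi]. destruct (Ho i x Hi) as [r [Hr H]].
    exists (exist _ (x, r, i) H). unfold ctr, rad; simpl. rewrite cms_d_refl. exact Hr. }
  pose (li := nodup eqI (map ind l)).
  (* Beyond the list [s a] is [i0], and [psi a] is still supported in [U i0], so the support
     property holds for every [a]. *)
  pose (s := fun a => nth a li i0).
  pose (bump := fun (i : I) (t : J) (x : X) =>
    if eqI (ind t) i then Rmax 0 (rad t - cms_d X (ctr t) x) else 0).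
  pose (psi := fun (a : nat) (x : X) => fold_right (fun t acc => bump (s a) t x + acc) 0 l).
  assert (Hb : forall i t x, 0 <= bump i t x).
  { intros i t x. unfold bump. destruct (eqI (ind t) i); [apply Rmax_l|lra]. }
  assert (Hnn : forall l' i x, 0 <= fold_right (fun t acc => bump i t x + acc) 0 l').
  { intros l' i x. induction l' as [|t l' IH]; simpl; [lra|]. pose proof (Hb i t x). lra. }
  assert (Hfold : forall l' t i x, In t l' -> 0 < bump i t x ->
    0 < fold_right (fun t acc => bump i t x + acc) 0 l').
  { intros l' t i x Ht Hx. induction l' as [|t' l' IH]; [destruct Ht|]. simpl.
    pose proof (Hnn l' i x). pose proof (Hb i t' x).
    destruct Ht as [->|Ht]; [lra|specialize (IH Ht); lra]. }
  assert (Hpsi0 : forall a x, psi a x <> 0 -> U (s a) x).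
  { intros a x. unfold psi. generalize l. intros l'. induction l' as [|t l' IH]; simpl; [tauto|].
    intros H. destruct (Req_dec (bump (s a) t x) 0) as [E|E];
      [apply IH; intros E'; apply H; lra|].
    unfold bump in E. destruct (eqI (ind t) (s a)) as [<-|]; [|tauto].
    apply (proj2_sig t). fold (ctr t) (rad t).
    unfold Rmax in E. destruct (Rle_dec 0 (rad t - cms_d X (ctr t) x)); [lra|tauto]. }
  assert (Hpos : forall x, 0 < rsum (length li) (fun a => psi a x)).
  { intros x. destruct (Hl x) as [t [Ht Hx]].
    assert (Hin : In (ind t) li) by (apply nodup_In, in_map; exact Ht).
    destruct (In_nth li (ind t) i0 Hin) as [a [Ha Hs]].
    apply rsum_pos with a; auto; [intros; apply Hnn|].
    apply (Hfold l t); auto. unfold bump.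
    replace (ind t) with (s a) by exact Hs. destruct (eqI (s a) (s a)); [|tauto].
    apply Rlt_le_trans with (2 := Rmax_r _ _). lra. }
  exists (length li), s, (fun a x => psi a x * / rsum (length li) (fun b => psi b x)).
  assert (Hcont : forall a, contR X (psi a)).
  { intros a. unfold psi. generalize l. intros l'. induction l' as [|t l' IH]; simpl;
      [apply contR_const|].
    apply contR_plus; auto. unfold bump.
    destruct (eqI (ind t) (s a)); [apply contR_bump|apply contR_const]. }
  repeat split.
  - intros a b Ha Hb' E. apply (NoDup_nth li i0); auto. apply NoDup_nodup.
  - intros a. apply contR_mult; auto. apply contR_inv.
    + apply contR_rsum; auto.
    + intros x. apply Rgt_not_eq, Hpos.
  - intros a x. apply Rmult_le_pos; [apply Hnn|]. left. apply Rinv_0_lt_compat; auto.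
  - intros a x H. apply Hpsi0. intros E. apply H. rewrite E. ring.
  - intros x. rewrite rsum_mult_r. pose proof (Hpos x). field. lra.
Qed.

(** * Block maps from widim and general position *)

Lemma dmax_ge (X : CompactMetricSpace) (T : X -> X) (n i : nat) (x y : X) :
  (i < n)%nat -> cms_d X (Nat.iter i T x) (Nat.iter i T y) <= dmax X T n x y.
Proof.
  intros Hi. assert (Hin : In i (seq 0 n)) by (apply in_seq; lia).
  unfold dmax. revert Hin. generalize (seq 0 n). intros l Hin.
  induction l as [|j l IH]; [destruct Hin|]. simpl. destruct Hin as [->|Hin].
  - apply Rmax_l.
  - apply Rle_trans with (2 := Rmax_r _ _). auto.
Qed.

Lemma dmax_open (X : CompactMetricSpace) (T : X -> X) (n : nat) (U : X -> Prop) :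
  continuous X X T -> d_open (dmax X T n) U -> d_open (cms_d X) U.
Proof.
  intros HT HU x Hx. destruct (HU x Hx) as [r [Hr H]].
  enough (HH : exists del, 0 < del /\ forall y, cms_d X x y < del -> dmax X T n x y < r).
  { destruct HH as [del [Hdel HH]]. exists del; auto. }
  clear H HU. unfold dmax. generalize (seq 0 n). intros l.
  induction l as [|i l [d1 [Hd1 IH]]]; simpl.
  - exists 1. split; [lra|auto].
  - destruct (continuous_iter X T i HT x r Hr) as [d2 [Hd2 H2]].
    exists (Rmin d1 d2). split; [apply Rmin_pos; auto|]. intros y Hy.
    pose proof (Rmin_l d1 d2). pose proof (Rmin_r d1 d2).
    apply Rmax_lub_lt; [apply H2|apply IH]; lra.
Qed.

Lemma order_bound (X : CompactMetricSpace) (I : Type) (U : I -> X -> Prop) (s : nat -> I)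
  (L k : nat) (x : X) :
  (forall a b, (a < L)%nat -> (b < L)%nat -> s a = s b -> a = b) ->
  (forall l : list I, NoDup l -> length l = (k + 2)%nat ->
     ~ exists x, forall i, In i l -> U i x) ->
  exists l : list nat, (length l <= k + 1)%nat /\
    forall a, (a < L)%nat -> U (s a) x -> In a l.
Proof.
  intros Hs HU.
  assert (HL : exists l : list nat, NoDup l /\
    forall a, In a l <-> (a < L)%nat /\ U (s a) x).
  { exists (filter (fun a => if excluded_middle_informative (U (s a) x) then true else false)
      (seq 0 L)). split; [apply NoDup_filter, seq_NoDup|].
    intros a. rewrite filter_In, in_seq.
    destruct (excluded_middle_informative (U (s a) x)); intuition (lia || discriminate). }
  destruct HL as [l [Hnd Hl]]. exists l. split; [|intros; apply Hl; auto].
  apply Nat.nlt_ge. intros Hlt.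
  apply (HU (map s (firstn (k + 2) l))).
  - assert (Hsub : incl (firstn (k + 2) l) l).
    { intros a Ha. rewrite <- (firstn_skipn (k + 2) l). apply in_or_app; auto. }
    assert (Hnd' : NoDup (firstn (k + 2) l)).
    { rewrite <- (firstn_skipn (k + 2) l) in Hnd. apply NoDup_app_remove_r in Hnd. exact Hnd. }
    clear Hlt. induction (firstn (k + 2) l) as [|a l' IH]; simpl; constructor.
    + inversion Hnd' as [|? ? Hni _]; subst. rewrite in_map_iff. intros [b [E Hb]].
      apply Hni. replace a with b; auto. apply Hs; auto; apply Hl, Hsub; simpl; auto.
    + inversion Hnd'; subst. apply IH; auto. intros b Hb. apply Hsub. simpl; auto.
  - rewrite length_map, length_firstn. lia.
  - exists x. intros i Hi. apply in_map_iff in Hi. destruct Hi as [a [<- Ha]].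
    apply Hl. rewrite <- (firstn_skipn (k + 2) l). apply in_or_app; auto.
Qed.

(* The general position argument: the nerve of a cover of order [k] is mapped linearly to
   [R^(n*D)], and [2k+2] vertices in general position are affinely independent there.
   The coordinate [t*D+i] approximates the [i]-th coordinate of [f] at time [t]. *)
Lemma block_map (X : CompactMetricSpace) (T : X -> X) (D n k : nat)
  (f : X -> nat -> R) (eps del : R) :
  (0 < D)%nat -> continuous X X T -> cube_map X D f -> 0 < del ->
  (forall x y, cms_d X x y < eps -> forall i, (i < D)%nat -> Rabs (f x i - f y i) < del) ->
  widim_le X T eps n k -> (2 * k + 1 <= n * D)%nat ->
  exists F : X -> nat -> R,
    (forall j, contR X (fun x => F x j)) /\
    (forall x j, 0 <= F x j <= 1) /\
    (forall x t i, (t < n)%nat -> (i < D)%nat ->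
       Rabs (F x (t * D + i)%nat - f (Nat.iter t T x) i) <= 2 * del) /\
    (forall x y, (forall j, (j < n * D)%nat -> F x j = F y j) -> dmax X T n x y < eps).
Proof.
  intros HD HT Hf Hdel Hunif (I & U & Uo & Uc & Ud & Uord) Hk.
  (* An empty [X] offers neither a default member [i0] nor a default sample point [x0]. *)
  destruct (classic (exists x : X, True)) as [[x0 _]|Hempty].
  2: { exists (fun _ _ => 0).
    split; [intros j; apply contR_const|]. split; [intros; lra|].
    split; intros x; exfalso; eauto. }
  destruct (Uc x0) as [i0 _].
  destruct (partition_of_unity X I i0 U) as (L & s & phi & Hs & Hpc & Hp0 & HpU & Hp1); auto.
  { intros i. apply dmax_open with T n; auto. }
  (* The vertex [a] is to go near the orbit block of [f] at a sample point [z a] of its member; for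
     an empty member [phi a] vanishes and any point serves. *)
  assert (Hz : forall a, exists z, (exists x, U (s a) x) -> U (s a) z).
  { intros a. destruct (classic (exists x, U (s a) x)) as [[x Hx]|Hn]; [eauto|].
    exists x0. tauto. }
  destruct (functional_choice _ _ _ Hz) as [z Hz']. clear Hz.
  destruct (@GeneralPosition.general_position_R (n * D) L
    (fun a j => f (Nat.iter (j / D) T (z a)) (j mod D)) del Hdel) as (q & Hq01 & Hqp & Hqi).
  { intros a j. apply Hf. apply Nat.mod_upper_bound. lia. }
  exists (fun x j => rsum L (fun a => phi a x * q a j)).
  split; [|split; [|split]].
  - intros j. apply (contR_rsum X L (fun a x => phi a x * q a j)). intros a.
    apply contR_mult; auto. apply contR_const.
  - intros x j. split.
    + rewrite <- (rsum_zero L (fun _ => 0)) by reflexivity. apply rsum_le. intros a _.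
      apply Rmult_le_pos; auto. apply Hq01.
    + rewrite <- (Hp1 x). apply rsum_le. intros a _. pose proof (Hp0 a x).
      pose proof (Hq01 a j). nra.
  - intros x t i Ht Hi. set (v := f (Nat.iter t T x) i). set (j := (t * D + i)%nat).
    (* One [del] is the displacement of the vertex. The other is the oscillation of [f] between
       [z a] and [x], which stay [eps]-close up to time [n]. Convex combinations preserve the
       bound. *)
    assert (Hterm : forall a, phi a x * (v - 2 * del) <= phi a x * q a j <= phi a x * (v + 2 * del)).
    { intros a. destruct (Req_dec (phi a x) 0) as [->|Hne]; [lra|].
      assert (Hx := HpU a x Hne). assert (Hza := Hz' a (ex_intro _ x Hx)).
      destruct (Ud (s a)) as [r [Hr Hdiam]].
      pose proof (dmax_ge X T n t (z a) x Ht) as A1.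
      pose proof (Hdiam (z a) x Hza Hx) as A2.
      pose proof (Hunif _ _ ltac:(eapply Rle_lt_trans; [exact A1|lra]) i Hi) as A3. fold v in A3.
      pose proof (Hqp a j) as A4.
      replace (j / D)%nat with t in A4
        by (unfold j; rewrite Nat.add_comm, Nat.div_add, Nat.div_small; lia).
      replace (j mod D)%nat with i in A4
        by (unfold j; rewrite Nat.add_comm, Nat.Div0.mod_add, Nat.mod_small; lia).
      apply Rabs_def2 in A3. pose proof (Hp0 a x).
      unfold Rabs in A4. destruct (Rcase_abs _) in A4;
        split; apply Rmult_le_compat_l; lra. }
    assert (B1 : rsum L (fun a => phi a x * (v - 2 * del)) <= rsum L (fun a => phi a x * q a j))
      by (apply rsum_le; intros; apply Hterm).
    assert (B2 : rsum L (fun a => phi a x * q a j) <= rsum L (fun a => phi a x * (v + 2 * del)))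
      by (apply rsum_le; intros; apply Hterm).
    rewrite rsum_mult_r, Hp1 in B1. rewrite rsum_mult_r, Hp1 in B2.
    apply Rabs_le. lra.
  - intros x y Hxy.
    destruct (order_bound X I U s L k x Hs Uord) as [lx [Hlx Hx]].
    destruct (order_bound X I U s L k y Hs Uord) as [ly [Hly Hy]].
    assert (Hc : forall a, (a < L)%nat -> phi a x - phi a y = 0).
    { apply (Hqi (fun a => phi a x - phi a y) (lx ++ ly)).
      - rewrite length_app. lia.
      - intros a Ha Hne. apply in_or_app.
        destruct (Req_dec (phi a x) 0) as [E|E]; [right|left]; auto.
        apply Hy, HpU; auto. intros E'. apply Hne. lra.
      - rewrite rsum_minus, !Hp1. lra.
      - intros j Hj. rewrite (rsum_ext L _ (fun a => phi a x * q a j - phi a y * q a j))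
          by (intros; ring).
        rewrite rsum_minus, (Hxy j Hj). lra. }
    (* A vertex with [phi a x <> 0] now also has [phi a y <> 0], which puts [x] and [y] in one
       member of small diameter. *)
    assert (Ha : exists a, (a < L)%nat /\ phi a x <> 0).
    { apply NNPP. intros Hn. pose proof (Hp1 x) as E. rewrite rsum_zero in E; [lra|].
      intros a Ha. apply NNPP. intros Hne. apply Hn. eauto. }
    destruct Ha as [a [Ha Hne]].
    destruct (Ud (s a)) as [r [Hr Hdiam]].
    apply Rle_lt_trans with (2 := Hr). specialize (Hc a Ha).
    apply Hdiam; apply HpU; auto. intros E. apply Hne. lra.
Qed.

Lemma block_maps (X : CompactMetricSpace) (T : X -> X) (D : nat)
  (f : X -> nat -> R) (eps del : R) :
  (0 < D)%nat -> continuous X X T -> cube_map X D f -> mdim_lt X T (INR D / 2) ->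
  0 < eps -> 0 < del ->
  exists (N : nat) (F : nat -> X -> nat -> R), forall n, (N < n)%nat ->
    (forall j, contR X (fun x => F n x j)) /\
    (forall x j, 0 <= F n x j <= 1) /\
    (forall x t i, (t < n)%nat -> (i < D)%nat ->
       Rabs (F n x (t * D + i)%nat - f (Nat.iter t T x) i) <= 2 * del) /\
    (forall x y, (forall j, (j < n * D)%nat -> F n x j = F n y j) -> dmax X T n x y < eps).
Proof.
  intros HD HT Hf (c & Hc & Hmd) Heps Hdel.
  destruct (cube_map_unif X D f del Hf Hdel) as [eps1 [Heps1 Hunif]].
  (* Members finer than [eps1] control the oscillation of [f], those finer than [eps] give the
     embedding. *)
  assert (He : 0 < Rmin eps eps1) by (apply Rmin_pos; auto).
  (* With [eta] half the margin [INR D / 2 - c], the slope [c + eta] stays below [INR D / 2], so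
     [2 * k < n * D]. *)
  destruct (Hmd (Rmin eps eps1) ((INR D / 2 - c) / 2) He ltac:(lra)) as [N HN].
  exists N. apply (functional_choice nat (X -> nat -> R) (fun n F => (N < n)%nat ->
    (forall j, contR X (fun x => F x j)) /\ (forall x j, 0 <= F x j <= 1) /\
    (forall x t i, (t < n)%nat -> (i < D)%nat ->
       Rabs (F x (t * D + i)%nat - f (Nat.iter t T x) i) <= 2 * del) /\
    (forall x y, (forall j, (j < n * D)%nat -> F x j = F y j) -> dmax X T n x y < eps))).
  intros n. destruct (le_lt_dec n N) as [L|G].
  { exists (fun _ _ => 0). lia. }
  destruct (HN n ltac:(lia) ltac:(lia)) as [k [Hk Hw]].
  assert (H2k : (2 * k + 1 <= n * D)%nat).
  { enough (2 * k < n * D)%nat by lia. apply INR_lt. rewrite !mult_INR. simpl (INR 2).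
    assert (0 < INR n) by (apply lt_0_INR; lia). nra. }
  destruct (block_map X T D n k f (Rmin eps eps1) del HD HT Hf Hdel) as (F & F1 & F2 & F3 & F4);
    auto.
  { intros x y Hxy. apply Hunif. pose proof (Rmin_r eps eps1). lra. }
  exists F. intros _. repeat split; auto; try apply F2.
  intros x y Hxy. specialize (F4 x y Hxy). pose proof (Rmin_l eps eps1). lra.
Qed.

(** * Density of uniform embeddings and conclusion *)

Lemma unif_embedding_dense (X Zs : CompactMetricSpace) (T Tinv : X -> X) (D : nat)
  (S Sinv : Zs -> Zs) (pi : X -> Zs) (eps : R) :
  (0 < D)%nat -> is_homeo X T Tinv -> is_homeo Zs S Sinv -> aperiodic Zs S ->
  zero_dim Zs -> factor_map X Zs T S pi -> mdim_lt X T (INR D / 2) -> 0 < eps ->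
  C_dense X D (unif_embedding X Zs T Tinv D pi eps).
Proof.
  intros HD hT hS hap hzd [Hpi [_ Hcomm]] hmd Heps f Hf e He.
  pose proof hT as (HT & HTi & HTK & HTiK). pose proof hS as (HS & HSi & HSK & HSiK).
  (* Block maps are accurate up to [2 * (e / 4) = e / 2], strictly below [e] as [uball] demands. The
     resulting [N] is then the gap of the markers, so [F (a + b)] is under control for every
     block. *)
  destruct (block_maps X T D f eps (e / 4) HD HT Hf hmd Heps ltac:(lra)) as (N & F & HF).
  destruct (marker_set Zs S Sinv N hS hap hzd) as (W & HW & HWd & HWc).
  assert (Hab : forall z, exists ab : nat * nat, marker_block Zs S Sinv W z (fst ab) (snd ab)).
  { intros z. destruct (marker_block_exists Zs S Sinv W N z hS HWc) as (a & b & H).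
    exists (a, b); auto. }
  destruct (functional_choice _ _ _ Hab) as [ab Hab']. clear Hab.
  assert (Hlen : forall z a b, marker_block Zs S Sinv W z a b -> (N < a + b)%nat)
    by (intros z a b; apply marker_block_length; auto).
  (* [T^(-a) x] is the start of the block and [x] sits at its position [a], so the value is letter
     [a] of the perturbed block; coordinates from [D] on are 0, as [cube_map] prescribes. *)
  pose (blk := fun (a b : nat) (x : X) (i : nat) =>
    if lt_dec i D then F (a + b)%nat (iterZ T Tinv (- Z.of_nat a) x) (a * D + i)%nat else 0).
  pose (g := fun x => blk (fst (ab (pi x))) (snd (ab (pi x))) x).
  assert (Hg : forall x a b, marker_block Zs S Sinv W (pi x) a b -> g x = blk a b x).
  { intros x a b H. unfold g.
    destruct (marker_block_unique Zs S Sinv W (pi x) _ _ a b (Hab' (pi x)) H) as [-> ->].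
    reflexivity. }
  assert (Hmb : forall x, exists a b, marker_block Zs S Sinv W (pi x) a b /\ g x = blk a b x).
  { intros x. exists (fst (ab (pi x))), (snd (ab (pi x))). split; [apply Hab'|reflexivity]. }
  assert (Hgc : cube_map X D g).
  { split; [|split].
    - intros x i Hi. destruct (Hmb x) as (a & b & Hm & ->). unfold blk.
      destruct (lt_dec i D); [|lia]. apply HF. eauto.
    - intros x i Hi. destruct (Hmb x) as (a & b & Hm & ->). unfold blk.
      destruct (lt_dec i D); [lia|reflexivity].
    - intros x e' He'. destruct (Hmb x) as (a & b & Hm & Hgx).
      destruct (marker_block_local Zs S Sinv W (pi x) a b hS HW Hm) as [r [Hr Hloc]].
      destruct (Hpi x r Hr) as [d1 [Hd1 H1]].
      (* One radius for all [i < D] comes from [common_radius], with the coordinates viewed as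
         integers [m] of absolute value at most [D]. *)
      assert (Hcommon : exists d2, 0 < d2 /\ forall y, cms_d X x y < d2 ->
        forall m, (Z.abs m <= Z.of_nat D)%Z ->
          Rabs (F (a + b)%nat (iterZ T Tinv (- Z.of_nat a) x) (a * D + Z.abs_nat m)%nat
            - F (a + b)%nat (iterZ T Tinv (- Z.of_nat a) y) (a * D + Z.abs_nat m)%nat) < e').
      { apply (common_radius X x (fun m y =>
          Rabs (F (a + b)%nat (iterZ T Tinv (- Z.of_nat a) x) (a * D + Z.abs_nat m)%nat
            - F (a + b)%nat (iterZ T Tinv (- Z.of_nat a) y) (a * D + Z.abs_nat m)%nat) < e')).
        intros m.
        destruct (HF (a + b)%nat (Hlen _ _ _ Hm)) as (HFc & _).
        destruct (HFc (a * D + Z.abs_nat m)%nat (iterZ T Tinv (- Z.of_nat a) x) e' He')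
          as [r' [Hr' H']].
        destruct (continuous_iterZ X T Tinv (- Z.of_nat a) HT HTi x r' Hr') as [r'' [Hr'' H'']].
        exists r''. split; auto. }
      destruct Hcommon as [d2 [Hd2 H2]].
      exists (Rmin d1 d2). split; [apply Rmin_pos; auto|]. intros y Hy i Hi.
      pose proof (Rmin_l d1 d2). pose proof (Rmin_r d1 d2).
      rewrite Hgx, (Hg y a b) by (apply Hloc, H1; lra). unfold blk.
      destruct (lt_dec i D); [|lia].
      pose proof (H2 y ltac:(lra) (Z.of_nat i) ltac:(lia)) as A.
      rewrite Zabs2Nat.id in A. exact A. }
  exists g. split; [exact Hgc|split].
  - apply unif_embedding_of_fibers; auto.
    intros x x' Heq Hz. destruct (Hmb x) as (a & b & Hm & _).
    set (n := (a + b)%nat). set (w := iterZ T Tinv (- Z.of_nat a)).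
    pose proof Hm as (Hb & _).
    assert (Hadd : forall p q u, iterZ T Tinv (p + q) u = iterZ T Tinv p (iterZ T Tinv q u))
      by (intros; apply iterZ_add; auto).
    (* The values of [g] at the times from [-a] to [b - 1] spell out all of [F n (w u)]. *)
    assert (Hshift : forall u t i, marker_block Zs S Sinv W (pi u) a b -> (t < n)%nat -> (i < D)%nat ->
      I_f X T Tinv g u (Z.of_nat t - Z.of_nat a) i = F n (w u) (t * D + i)%nat).
    { intros u t i Hu Ht Hi. unfold I_f.
      pose proof (marker_block_shift Zs S Sinv W (pi u) a b t hS Hu Ht) as Hs.
      rewrite <- (iterZ_semiconj X Zs T Tinv S Sinv pi) in Hs by auto.
      rewrite (Hg _ _ _ Hs). unfold blk. destruct (lt_dec i D); [|lia].
      rewrite <- Hadd. unfold w, n. replace (t + (a + b - t))%nat with (a + b)%nat by (unfold n in Ht; lia).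
      do 2 f_equal. lia. }
    destruct (HF n (Hlen _ _ _ Hm)) as (_ & _ & _ & HFi).
    assert (Hd : dmax X T n (w x) (w x') < eps).
    { apply HFi. intros j Hj.
      assert (Ht : (j / D < n)%nat) by (apply Nat.Div0.div_lt_upper_bound; lia).
      assert (Hi : (j mod D < D)%nat) by (apply Nat.mod_upper_bound; lia).
      replace j with (j / D * D + j mod D)%nat
        by (pose proof (Nat.div_mod_eq j D); lia).
      rewrite <- !Hshift by (try rewrite <- Hz; auto). apply Heq; auto. }
    (* The original points are the iterates of the block starts at time [a], one of the times
       counted by [dmax] because [b > 0]. *)
    pose proof (dmax_ge X T n a (w x) (w x') ltac:(unfold n; lia)) as A.
    unfold w in A at 1 2. rewrite <- !(iterZ_of_nat X T Tinv), <- !Hadd in A.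
    replace (Z.of_nat a + - Z.of_nat a)%Z with 0%Z in A by lia. simpl in A. lra.
  - exists (e / 2). split; [lra|]. intros x i Hi. rewrite Rabs_minus_sym.
    destruct (Hmb x) as (a & b & Hm & ->). unfold blk. destruct (lt_dec i D); [|lia].
    destruct (HF (a + b)%nat (Hlen _ _ _ Hm)) as (_ & _ & HFa & _).
    pose proof Hm as (Hb & _).
    pose proof (HFa (iterZ T Tinv (- Z.of_nat a) x) a i ltac:(lia) Hi) as A.
    rewrite <- (iterZ_of_nat X T Tinv), <- iterZ_add in A by auto.
    replace (Z.of_nat a + - Z.of_nat a)%Z with 0%Z in A by lia. simpl in A.
    replace (e / 2) with (2 * (e / 4)) by field. exact A.
Qed.

Theorem mainTheorem1 (D : nat) (X Zs : CompactMetricSpace)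
  (T Tinv : X -> X) (S Sinv : Zs -> Zs) (pi : X -> Zs)
  (hD : (0 < D)%nat)
  (hT : is_homeo X T Tinv) (hS : is_homeo Zs S Sinv)
  (hap : aperiodic Zs S) (hzd : zero_dim Zs)
  (hpi : factor_map X Zs T S pi)
  (hmd : mdim_lt X T (INR D / 2)) :
  (exists f, cube_map X D f /\ embedding_pair X Zs T Tinv D f pi) /\
  comeagre_C X D (fun f => embedding_pair X Zs T Tinv D f pi).
Proof.
  pose (U := fun k => unif_embedding X Zs T Tinv D pi (/ (INR k + 1))).
  assert (Ho : forall k, C_open X D (U k)) by (intros k; apply unif_embedding_open).
  assert (Hd : forall k, C_dense X D (U k)).
  { intros k. apply unif_embedding_dense with S Sinv; auto. apply inv_INR_pos. }
  assert (HU : forall f, cube_map X D f -> (forall k, U k f) ->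
    embedding_pair X Zs T Tinv D f pi).
  { intros f Hf H. apply embedding_of_unif; auto; [apply hT|apply hT|apply hpi]. }
  split.
  - destruct (baire_cube X D U Ho Hd) as (f & Hf & H). eauto.
  - exists U. auto.
Qed.
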